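(* For $k\in\mathbb N$ and $q\in(0,1)$ let $x_k(q)$ be the $k$-th zero (in decreasing order, $\cdots<x_2(q)<x_1(q)<0$) of $f(x;q)=\sum_{n\ge0}\frac{x^n}{n!}q^{n(n-1)/2}$, and let $w_k(q):=-q^{k-1}x_k(q)/k$. The function $w_k$ extends analytically to a neighbourhood of $q=0$ with $w_k(0)=1$; define the coefficients $a_{k,n}$, $\hat a_{k,n}$ ($n\ge1$) by the expansions \[ w_k(q)=1+\sum_{n\ge1}a_{k,n}q^n,\qquad \frac{1}{w_k(q)}=1-\sum_{n\ge1}\hat a_{k,n}q^n \] near $q=0$. For $n,l\ge1$ let $\gamma_{n,l}=\lfloor 2n/(l(l+1))\rfloor$, $Q_n(x)=x^n\prod_{l\ge1}(x+l)^{\gamma_{n,l}}$, $\mu_j(n)=\sum_{l\ge1}l^j\gamma_{n,l}$, and $M_n=\deg(Q_n)=\mu_0(n)+n$. Let $\sigma(n)=\sum_{d\mid n}d$. Then: (i) There exist polynomials $P_n,\widehat P_n\in\mathbb Z[x]$ ($n\ge1$) such that for all $k,n\ge1$, \[ a_{k,n}=\frac{P_n(k)}{Q_n(k)},\qquad \hat a_{k,n}=\frac{\widehat P_n(k)}{Q_n(k)}. \] (ii) $M_n<3n$ for all $n\ge1$, and $M_n/n\to3$ as $n\to\infty$. For $n\ge2$, each of the polynomials $P_n$ and $\widehat P_n$ has the form \[ \sigma(n)k^{M_n-2}+\sigma(n)\bigl(\mu_1(n)-n\bigr)k^{M_n-3}+\text{(terms of degree at most } M_n-4), \] and the coefficient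 $\sigma(n)(\mu_1(n)-n)$ is zero for $n=2$ and positive for all $n\ge3$.
   Context: For $q\in(0,1)$ the zeros of $f(\cdot;q)$ are infinitely many, simple and negative. It is known (Sokal) that for $0<|q|<0.207875$ each $x_k$ is analytic with a Laurent expansion of the form $x_k(q)=-kq^{1-k}(1+O(q))$, so that $w_k$ is analytic near $0$ with $w_k(0)=1$. Note $\gamma_{n,l}=0$ for $l\ge\sqrt{2n}$, so $Q_n\in\mathbb Z[x]$ is a polynomial. *)

(* Defs.v *)
From HB Require Import structures.
From mathcomp Require Import all_boot all_order all_algebra.
From mathcomp Require Import all_classical all_reals all_analysis.
Set Implicit Arguments. Unset Strict Implicit. Unset Printing Implicit Defensive.
Import Order.TTheory GRing.Theory Num.Theory.
Import numFieldNormedType.Exports.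
Local Open Scope ring_scope.

Definition fq {R : realType} (q x : R) : R :=
  limn (series (fun n : nat => x ^+ n / (n`!)%:R * q ^+ (n * n.-1)./2)).

Definition kth_zero {R : realType} (q : R) (k : nat) (x : R) : Prop :=
  fq q x = 0 /\
  exists s : seq R, uniq s /\ size s = k.-1 /\
    forall y : R, y \in s <-> (fq q y = 0 /\ x < y).

Definition gam (n l : nat) : nat := (2 * n) %/ (l * l.+1).

(* Q_n(x) = x^n prod_{l>=1} (x+l)^{gamma_{n,l}}; gamma_{n,l} = 0 for l > n *)
Definition Qpoly (n : nat) : {poly int} :=
  'X^n * \prod_(1 <= l < n.+1) ('X + (l%:Z)%:P) ^+ gam n l.

Definition mu (j n : nat) : nat := \sum_(1 <= l < n.+1) l ^ j * gam n l.

Definition Mdeg (n : nat) : nat := (size (Qpoly n)).-1.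

Definition sigma (n : nat) : nat := \sum_(d <- divisors n) d.

Definition coef_ratio {R : realType} (P : {poly int}) (n k : nat) : R :=
  (P.[k%:Z])%:~R / ((Qpoly n).[k%:Z])%:~R.

Definition has_form (P : {poly int}) (n : nat) : Prop :=
  (forall i : nat, (Mdeg n - 2 < i)%N -> P`_i = 0) /\
  P`_(Mdeg n - 2) = (sigma n)%:Z /\
  P`_(Mdeg n - 3) = (sigma n)%:Z * ((mu 1 n)%:Z - n%:Z).

(* Main.v *)
(** Put [x = - k q^(1-k) w].  After division by its two dominant terms [n = k - 1] and [n = k],
    the equation [f(x; q) = 0] becomes, with [A_l = \prod_(i <= l) (1 + i/k)^-1] and
    [B_l = \prod_(i <= l) (1 - i/k)],
      [1 + S_B (1/w) = w (1 + S_A w)],  [S_a w = \sum_(l >= 1) (-1)^l a_l q^(l(l+1)/2) w^l].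
    With [v = 1/w] this is a fixed-point system for the pair [(w, v)] of power series in [q].
    The denominators of [A_l] and [B_l] divide [Q_(l(l+1)/2)], and [Q_i Q_j] divides [Q_(i+j)],
    whence the form of the coefficients.  Modulo [t^4], where [t = 1/k], the solution is
    [w = 1 + t^2 (U - t q U')] and [v = 1 - t^2 (U - t q U')] with [U = \sum sigma(n) q^n]:
    this amounts to [J U = - q J' / 3] for [J = \sum (-1)^l (2l+1) q^(l(l+1)/2)], which follows
    from Jacobi's identity [J = \prod (1 - q^n)^3].  The system is a contraction for
    [q < 1/1000], uniformly in [k]; unless some [w] is of order one, a single term of the series
    dominates, so no other zeros occur. *)
Require Import Defs.
From HB Require Import structures.
From mathcomp Require Import all_boot all_order all_algebra.
From mathcomp Require Import all_classical all_reals all_analysis.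
From mathcomp Require Import ring lra zify.
Set Implicit Arguments. Unset Strict Implicit. Unset Printing Implicit Defensive.
Import Order.TTheory GRing.Theory Num.Theory.
Import numFieldNormedType.Exports.
Local Open Scope ring_scope.

(** * Jacobi's identity *)

(** Taking [v = 1/w] as a second unknown removes every inversion of a power series: [sol] is a
    polynomial recursion, so it can be run over the reals at [t = 1/k] and over [Z[t]/(t^4)] alike,
    and one induction carries integrality, degree bounds and expansion together. The system is
    symmetric under exchanging [(a, w)] with [(b, v)], so each estimate is proved once and used
    twice. The relation [w v = 1] is not imposed but deduced from the two equations in the limit.
    The modulus [t^4] is dictated by the statement: writing numerators in [1/k] reverses their
    coefficients, so degrees [M_n] down to [M_n - 3] in [k] become orders 0 to 3 in [t]. There the
    squares of the [t^2] corrections vanish and the system becomes linear. Power series are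
    polynomials taken modulo [X^(N+1)]; since the l-th summand has order at least [l] in [X], [N]
    steps determine the coefficients up to [N]. Uniformity in [k] allows the first [k] solutions to
    be compared at the same [q], which is what identifies the k-th zero. *)

Definition eqmX (K : nzRingType) (n : nat) (p q : {poly K}) :=
  forall i, (i < n)%N -> p`_i = q`_i.

(** * Truncated power series: congruence modulo [X^n] *)

Section CongruenceModXn.
Variable K : comNzRingType.
Implicit Types (p q : {poly K}) (n m : nat).

Lemma eqmX_sym n p q : eqmX n p q -> eqmX n q p.
Proof. by move=> h i /h. Qed.

Lemma eqmX_trans n q p r : eqmX n p q -> eqmX n q r -> eqmX n p r.
Proof. by move=> h1 h2 i lin; rewrite h1 // h2. Qed.

Lemma eqmX_leq n m p q : (m <= n)%N -> eqmX n p q -> eqmX m p q.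
Proof. by move=> lemn h i lim; apply: h; apply: leq_trans lemn. Qed.

Lemma eqmXD n p q p' q' : eqmX n p q -> eqmX n p' q' -> eqmX n (p + p') (q + q').
Proof. by move=> h1 h2 i lin; rewrite !coefD h1 // h2. Qed.

Lemma eqmXN n p q : eqmX n p q -> eqmX n (- p) (- q).
Proof. by move=> h i lin; rewrite !coefN h. Qed.

Lemma eqmXB n p q p' q' : eqmX n p q -> eqmX n p' q' -> eqmX n (p - p') (q - q').
Proof. by move=> h1 h2; apply: eqmXD => //; apply: eqmXN. Qed.

Lemma eqmXM n p q p' q' : eqmX n p q -> eqmX n p' q' -> eqmX n (p * p') (q * q').
Proof.
move=> h1 h2 i lin; rewrite !coefM; apply: eq_bigr => j _.
by rewrite h1 ?h2 //; [lia|have := ltn_ord j; lia].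
Qed.

Lemma eqmXMn n m p q : eqmX n p q -> eqmX n (p *+ m) (q *+ m).
Proof. by move=> h i lin; rewrite !coefMn h. Qed.

Lemma eqmXX n m p q : eqmX n p q -> eqmX n (p ^+ m) (q ^+ m).
Proof. by move=> h; elim: m => // m IH; rewrite !exprS; apply: eqmXM. Qed.

Lemma eqmX_sum n (I : Type) (r : seq I) (P : pred I) (F G : I -> {poly K}) :
  (forall i, P i -> eqmX n (F i) (G i)) ->
  eqmX n (\sum_(i <- r | P i) F i) (\sum_(i <- r | P i) G i).
Proof. by move=> h; apply: big_ind2 => //; apply: eqmXD. Qed.

Lemma eqmX_mulXn n m p q : eqmX n p q -> eqmX (m + n) ('X^m * p) ('X^m * q).
Proof.
move=> h i lin; rewrite !coefXnM; case: ltnP => // lemi.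
by apply: h; lia.
Qed.

Lemma eqmX_Xn0 n m p : (n <= m)%N -> eqmX n ('X^m * p) 0.
Proof. by move=> lenm i lin; rewrite coefXnM coef0; case: ltnP => //; lia. Qed.

(* A power series with constant term 1 is invertible. *)
Lemma eqmX_mulI n p q r : p`_0 = 1 -> eqmX n (p * q) (p * r) -> eqmX n q r.
Proof.
move=> p0 h i; elim/ltn_ind: i => i IH lin.
have := h i lin; rewrite !coefM !big_ord_recl p0 !mul1r subn0.
set s := \sum_(_ < _) _; set s' := \sum_(_ < _) _.
suff -> : s = s' by apply: addIr.
apply: eq_bigr => j _; congr (_ * _); apply: IH; rewrite /=; rewrite /bump /=;
  have := ltn_ord j; lia.
Qed.

Lemma eqmX_mul0 n m p q : eqmX m p 0 -> eqmX n q 0 -> eqmX (m + n) (p * q) 0.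
Proof.
move=> hp hq i li; rewrite coefM coef0 big1 // => j _.
case: (ltnP j m) => [ljm|lemj]; first by rewrite hp // coef0 mul0r.
by rewrite hq ?coef0 ?mulr0 //; have := ltn_ord j; lia.
Qed.

Lemma eqmX_subr0 n p q : eqmX n (p - q) 0 <-> eqmX n p q.
Proof.
split=> h i lin; first by apply/eqP; rewrite -subr_eq0 -coefB h ?coef0.
by rewrite coefB h // subrr coef0.
Qed.

Lemma eqmX_XderivM n p q : eqmX n p q -> eqmX n ('X * p^`()) ('X * q^`()).
Proof.
move=> h i lin; rewrite !coefXM; case: i lin => //= i lin.
by rewrite !coef_deriv h.
Qed.

End CongruenceModXn.

(** * The finite triple product *)

Definition triang (l : nat) : nat := 'C(l.+1, 2).

Lemma triang0 : triang 0 = 0. Proof. by []. Qed.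

Lemma triangS l : triang l.+1 = (triang l + l.+1)%N.
Proof. by rewrite /triang binS bin1. Qed.

Lemma leq_triang l : (l <= triang l)%N.
Proof. by elim: l => // l IH; rewrite triangS; lia. Qed.

Lemma triang_double l : (2 * triang l = l * l.+1)%N.
Proof. by elim: l => // l IH; rewrite triangS mulnDr IH; lia. Qed.

Definition qpoch (n : nat) : {poly int} := \prod_(1 <= i < n.+1) (1 - 'X^i).

Lemma qpoch0 : qpoch 0 = 1. Proof. by rewrite /qpoch big_geq. Qed.

Lemma qpochS n : qpoch n.+1 = qpoch n * (1 - 'X^(n.+1)).
Proof. by rewrite /qpoch big_nat_recr. Qed.

Lemma qpoch_coef0 n : (qpoch n)`_0 = 1.
Proof.
elim: n => [|n IH]; first by rewrite qpoch0 coef1.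
by rewrite qpochS coefM big_ord_recl big_ord0 IH coefB coef1 coefXn addr0 mul1r subr0.
Qed.

Lemma qpoch_eqmX n m : (n <= m)%N -> eqmX n.+1 (qpoch m) (qpoch n).
Proof.
move=> lenm; rewrite -(subnKC lenm); elim: (m - n)%N => [|d IH]; first by rewrite addn0.
rewrite addnS qpochS -[X in eqmX _ _ X]mulr1; apply: eqmXM => //.
apply/eqmX_subr0; rewrite addrAC subrr add0r -['X^_]mulr1 -[in X in eqmX _ _ X]oppr0.
by apply: eqmXN; apply: eqmX_Xn0; lia.
Qed.

(* [jac N m] is, up to sign, the coefficient of [z^(N + 1 + m)] in the product
   [(1 - z) \prod_(1 <= i <= N) (1 - z X^i) (X^i - z)]; that product is antisymmetric
   under [z -> 1/z], which is why only [m >= 0] is needed. *)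
Fixpoint jac (N m : nat) : {poly int} :=
  if N is N'.+1 then
    'X^N * (jac N' m.+1 + (if m is m'.+1 then jac N' m' else - jac N' 0))
    - (1 + 'X^N ^+ 2) * jac N' m
  else (m == 0)%:R.

Lemma jac_gt N m : (N < m)%N -> jac N m = 0.
Proof.
elim: N m => [|N IH] [|m] //= lt; rewrite !IH ?addr0 ?mulr0 ?subr0 //; lia.
Qed.

Lemma jac_diag N : jac N N = 'X^(triang N).
Proof.
elim: N => [|N IH] //=; rewrite (@jac_gt N N.+2) ?(@jac_gt N N.+1) // IH add0r mulr0 subr0 -exprD.
by rewrite triangS addnC.
Qed.

(** Gauss's q-binomial theorem: with [N = m + d], [jac N m] is [(-1)^d X^(triang m)] times the
    Gaussian binomial of [2N + 1] over [d], stated with denominators cleared. The induction on [N]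
    expresses the values at [m - 1], [m] and [m + 1] through the same [E]. *)
Lemma jac_closed m d :
  jac (m + d) m * (qpoch d * qpoch (m + m + d).+1) =
  (-1) ^+ d * 'X^(triang m) * qpoch (m + d + (m + d)).+1.
Proof.
move: {2}(m + d)%N (erefl (m + d)%N) => N; elim: N m d => [|N IH] m d.
  by case: m d => [|m] [|d] //= _; rewrite !mul1r qpoch0 mul1r.
case: d => [|d].
  by rewrite addn0 => _; rewrite addn0 jac_diag qpoch0 expr0 !mul1r.
rewrite addnS => -[eN]; rewrite eN /= -eN.
have e1 : (m + m + d.+1).+1 = (m + m + d).+2 by rewrite addnS.
have e2 : ((m + d).+1 + (m + d).+1).+1 = (m + d + (m + d)).+3 by rewrite addnS addSn.
rewrite e1 e2; set E := qpoch (m + d + (m + d)).+1.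
have h0 : jac (m + d) m * (qpoch d.+1 * qpoch (m + m + d).+2) =
   (1 - 'X^(d.+1)) * (1 - 'X^((m + m + d).+2)) * ((-1) ^+ d * 'X^(triang m) * E).
  by rewrite -IH // !qpochS; ring.
have h1 : jac (m + d) m.+1 * (qpoch d.+1 * qpoch (m + m + d).+2) =
   - ((1 - 'X^d) * (1 - 'X^(d.+1)) * ((-1) ^+ d * 'X^(triang m + m.+1) * E)).
  case: d eN @E {e1 e2 h0} => [|d] eN E.
    by rewrite jac_gt ?addn0 // expr0 subrr !mul0r oppr0.
  have := IH m.+1 d; rewrite addSnnS => /(_ eN).
  have -> : (m.+1 + m.+1 + d = (m + m + d.+1).+1)%N by lia.
  rewrite -/E triangS => h.
  transitivity ((1 - 'X^(d.+1)) * (1 - 'X^(d.+2)) * (jac (m + d.+1) m.+1 *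
    (qpoch d * qpoch (m + m + d.+1).+2))); last by rewrite h [(-1) ^+ d.+1]exprS; ring.
  by rewrite !qpochS; ring.
(* Since [triang (m - 1) = triang m - m], the factor ['X^m] avoids a negative exponent. At [m = 0]
   the antisymmetric value [- jac _ 0] fits the same formula. *)
have h2 : (if m is m'.+1 then jac (m + d) m' else - jac (m + d) 0) *
    (qpoch d.+1 * qpoch (m + m + d).+2) * 'X^m =
   - ((1 - 'X^((m + m + d).+1)) * (1 - 'X^((m + m + d).+2)) *
     ((-1) ^+ d * 'X^(triang m) * E)).
  case: m eN @E {e1 e2 h1} h0 => [|m] eN E h0.
    by rewrite mulNr h0 expr0 mulr1 !add0n.
  have := IH m d.+1; rewrite addnS => /(_ eN).
  have -> : ((m + d).+1 + (m + d).+1 = m.+1 + d + (m.+1 + d))%N by lia.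
  rewrite -/E triangS => h.
  transitivity ((1 - 'X^((m.+1 + m.+1 + d).+1)) * (1 - 'X^((m.+1 + m.+1 + d).+2))
    * 'X^(m.+1) * (jac (m + d).+1 m * (qpoch d.+1 * qpoch (m + m + d.+1).+1))).
    have -> : ((m + m + d.+1).+1 = m.+1 + m.+1 + d)%N by lia.
    by rewrite !qpochS addSn; ring.
  by rewrite h ['X^(_ + _)]exprD [(-1) ^+ d.+1]exprS; ring.
have eX : 'X^((m + d).+1) = 'X^(d.+1) * 'X^m :> {poly int}.
  by rewrite -exprD; congr ('X^_); lia.
move: h0 h1 h2; rewrite eX; set j2 := (if m is m'.+1 then jac (m + d) m' else - jac (m + d) 0).
move: (jac _ m) (jac _ m.+1) j2 => j0 j1 j2.
set Z := _ * qpoch _.+2 => h0 h1 h2.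
transitivity ('X^(d.+1) * ('X^m * (j1 * Z) + j2 * Z * 'X^m)
  - (1 + ('X^(d.+1) * 'X^m) ^+ 2) * (j0 * Z)); first by ring.
rewrite h0 h1 h2 2!qpochS -/E; move: E (triang m) {h0 h1 h2 Z} => E T.
have -> : ((m + d + (m + d)) = d + d + m + m)%N by lia.
rewrite !(exprS, exprD); ring.
Qed.

(** Up to sign, this is the derivative at [z = 1] of the product behind [jac]: the factor [1 - z]
    leaves [\prod (1 - X^i) (X^i - 1)], and by antisymmetry the powers [N + 1 + m] and [N - m] of
    [z] combine to the weight [2m + 1]. In the recurrence the neighbouring weights [2m - 1] and
    [2m + 3] add up to twice [2m + 1], and [2 X^n - (1 + X^(2n)) = - (1 - X^n)^2]. *)
Lemma jac_weighted_sum N :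
  \sum_(0 <= m < N.+1) jac N m *+ (2 * m).+1 = (-1) ^+ N * qpoch N ^+ 2.
Proof.
suff h M : (N < M)%N ->
    \sum_(0 <= m < M) jac N m *+ (2 * m).+1 = (-1) ^+ N * qpoch N ^+ 2.
  exact: h.
elim: N M => [|N IH] [|M] // lt.
  rewrite big_nat_recl // big1 ?addr0 ?qpoch0 ?expr1n ?mulr1 //= => i _.
  by rewrite mul0rn.
set S := \sum_(_ <= _ < _) _.
have e : S = ('X^(N.+1) *+ 2 - (1 + 'X^(N.+1) ^+ 2)) *
    \sum_(0 <= m < M.+1) jac N m *+ (2 * m).+1.
  rewrite /S => {S}.
  transitivity (\sum_(0 <= m < M.+1)
      ('X^(N.+1) * (jac N m.+1 *+ (2 * m).+1) - (1 + 'X^(N.+1) ^+ 2) * (jac N m *+ (2 * m).+1))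
    + 'X^(N.+1) * (- jac N 0 + \sum_(0 <= m < M) jac N m *+ (2 * m).+3)).
    rewrite big_nat_recl // [in RHS]big_nat_recl // mulrDr mulr_sumr addrACA.
    rewrite -big_split.
    congr (_ + _); first by rewrite /= !mulr1n; ring.
    apply: eq_bigr => i _ /=.
    have -> : ((2 * i.+1).+1 = (2 * i).+3)%N by lia.
    by rewrite mulrnBl -!mulrnAr mulrnDl mulrDr addrAC.
  rewrite sumrB -!mulr_sumr.
  (* At [m = 0] the truncated predecessor gives weight 0 instead of -1; the separate term
     [- jac N 0] makes up for it. *)
  have -> : \sum_(0 <= m < M.+1) jac N m.+1 *+ (2 * m).+1 =
      \sum_(0 <= m < M.+2) jac N m *+ (2 * m).-1.
    rewrite [RHS]big_nat_recl // muln0 mulr0n add0r.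
    by apply: eq_bigr => i _; congr (_ *+ _); lia.
  have -> : \sum_(0 <= m < M.+2) jac N m *+ (2 * m).-1 =
      \sum_(0 <= m < M.+1) jac N m *+ (2 * m).-1.
    by rewrite big_nat_recr //= (@jac_gt N M.+1) ?mul0rn ?addr0 //; lia.
  have -> : \sum_(0 <= m < M) jac N m *+ (2 * m).+3 =
      \sum_(0 <= m < M.+1) jac N m *+ (2 * m).+3.
    by rewrite [in RHS]big_nat_recr //= (@jac_gt N M) ?mul0rn ?addr0 //; lia.
  rewrite mulrBl; rewrite addrAC -mulrDr; congr (_ - _).
  rewrite mulrnAl -mulrnAr; congr (_ * _); rewrite addrCA -big_split /= -sumrMnl.
  rewrite !big_nat_recl //= addrA; congr (_ + _); first by rewrite mulr0n; ring.
  by apply: eq_bigr => i _; rewrite -mulrnDr -mulrnA; congr (_ *+ _); lia.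
rewrite e IH; last by lia.
by rewrite qpochS [(-1) ^+ N.+1]exprS; ring.
Qed.

Lemma jac_eqmX m d :
  eqmX (m + d).+1 (qpoch (m + d) * jac (m + d) m) ((-1) ^+ d * 'X^(triang m)).
Proof.
have c0 := qpoch_coef0.
have h1 : eqmX (m + d).+1 (qpoch d * jac (m + d) m) ((-1) ^+ d * 'X^(triang m)).
  apply: (@eqmX_mulI _ _ (qpoch (m + d))) => //.
  have e : eqmX (m + d).+1 (qpoch (m + d) * (qpoch d * jac (m + d) m))
      (jac (m + d) m * (qpoch d * qpoch (m + m + d).+1)).
    have -> : jac (m + d) m * (qpoch d * qpoch (m + m + d).+1) =
      qpoch (m + m + d).+1 * (qpoch d * jac (m + d) m) by ring.
    by apply: eqmXM => //; apply: eqmX_sym; apply: qpoch_eqmX; lia.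
  apply: eqmX_trans e _; rewrite jac_closed [X in eqmX _ X]mulrC.
  by apply: eqmXM => //; apply: qpoch_eqmX; lia.
(* [qpoch (m + d)] and [qpoch d] differ only from degree [d + 1] on, while [jac (m + d) m] starts at
   degree [triang m >= m] or beyond the precision; exchanging one for the other is therefore
   harmless modulo [X^(m + d + 1)]. *)
have hj : eqmX (minn (triang m) (m + d).+1) (jac (m + d) m) 0.
  apply: (@eqmX_mulI _ _ (qpoch d)) => //; rewrite mulr0.
  apply: eqmX_trans (eqmX_leq _ h1) _; first exact: geq_minr.
  by rewrite mulrC; apply: eqmX_Xn0; exact: geq_minl.
apply: eqmX_trans h1; apply/eqmX_subr0; rewrite -mulrBl.
have hE : eqmX d.+1 (qpoch (m + d) - qpoch d) 0.
  by apply/eqmX_subr0; apply: qpoch_eqmX; lia.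
apply: (eqmX_leq _ (eqmX_mul0 hE hj)).
by have := leq_triang m; lia.
Qed.

Definition jacobi_series (N : nat) : {poly int} :=
  \sum_(0 <= l < N.+1) (-1) ^+ l * 'X^(triang l) *+ (2 * l).+1.

(** Multiply [jac_weighted_sum] by [qpoch N]: to this precision each [qpoch N * jac N l] is a signed
    monomial. *)
Lemma jacobi_cube N : eqmX N.+1 (jacobi_series N) (qpoch N ^+ 3).
Proof.
have -> : qpoch N ^+ 3 = (-1) ^+ N * (qpoch N * ((-1) ^+ N * qpoch N ^+ 2)).
  transitivity ((-1) ^+ N * (-1) ^+ N * qpoch N ^+ 3); last by ring.
  by rewrite -exprMn mulrNN mulr1 expr1n mul1r.
rewrite -jac_weighted_sum mulr_sumr mulr_sumr /jacobi_series !big_nat.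
apply: eqmX_sum => l /andP[_ lel] i lin; rewrite !mulrnAr !coefMn; congr (_ *+ _).
have -> : (-1) ^+ l = (-1) ^+ N * (-1) ^+ (N - l) :> {poly int}.
  rewrite -exprD -signr_odd -[in RHS]signr_odd; congr (_ ^+ _); congr nat_of_bool.
  by rewrite oddD oddB //; case: (odd N); case: (odd l).
rewrite -mulrA; move: i lin; apply: eqmXM => //; apply: eqmX_sym.
by have := @jac_eqmX l (N - l); rewrite subnKC.
Qed.

(** The Lambert series of the [i X^i / (1 - X^i)], with two cut-offs: [M] follows the induction on
    the factors of [qpoch M], while [N] fixes the precision. *)
Definition lambert (N M : nat) : {poly int} :=
  \sum_(1 <= i < M.+1) (\sum_(1 <= m < N.+1) 'X^(i * m)) *+ i.

Lemma lambertS N M :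
  lambert N M.+1 = lambert N M + (\sum_(1 <= m < N.+1) 'X^(M.+1 * m)) *+ M.+1.
Proof. by rewrite /lambert big_nat_recr. Qed.

Lemma lambert_coef N n : (0 < n <= N)%N -> (lambert N N)`_n = (sigma n)%:Z.
Proof.
move=> /andP[n0 nN]; rewrite /lambert coef_sum /sigma.
transitivity ((\sum_(1 <= i < N.+1 | (i %| n)%N) i)%N%:Z); last first.
  congr Posz; rewrite -big_filter; apply: perm_big; apply: uniq_perm.
  - by rewrite filter_uniq // iota_uniq.
  - exact: divisors_uniq.
  move=> i; rewrite mem_filter mem_index_iota -dvdn_divisors //.
  apply/andP/idP => [[]//|d]; split=> //.
  by rewrite (dvdn_gt0 n0 d) ltnS (leq_trans (dvdn_leq n0 d)).
rewrite -natz natr_sum [RHS]big_mkcond /= !big_nat; apply: eq_bigr => i /andP[i0 iN].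
rewrite coefMn coef_sum; case: ifP => [/dvdnP[m em]|ndiv].
  rewrite (bigD1_seq m) ?iota_uniq //=; last by rewrite mem_index_iota; nia.
  rewrite big1 => [|j /negPf njm]; first by rewrite addr0 coefXn mulnC em eqxx.
  by rewrite coefXn em mulnC eqn_pmul2l // eq_sym njm.
rewrite big1 ?mul0rn // => j _; rewrite coefXn; case: eqP => // e.
by rewrite e dvdn_mulr in ndiv.
Qed.

Lemma geometric_tail (K : comNzRingType) (x : K) N :
  (1 - x) * \sum_(1 <= m < N.+1) x ^+ m = x - x ^+ N.+1.
Proof.
elim: N => [|N IH]; first by rewrite big_geq // mulr0 expr1 subrr.
by rewrite big_nat_recr //= mulrDr IH [x ^+ N.+2]exprS; ring.
Qed.

Lemma qpoch_lambert N M :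
  eqmX N.+1 (qpoch M * lambert N M) (- ('X * (qpoch M)^`())).
Proof.
elim: M => [|M IH].
  by rewrite /lambert big_geq // mulr0 qpoch0 derivC mulr0 oppr0.
rewrite lambertS qpochS derivM derivB derivC derivXn sub0r.
set G := \sum_(1 <= m < N.+1) _.
have hG : (1 - 'X^(M.+1)) * G = 'X^(M.+1) - 'X^(M.+1) ^+ N.+1.
  by rewrite /G -geometric_tail; under eq_bigr do rewrite exprM.
have -> : qpoch M * (1 - 'X^(M.+1)) * (lambert N M + G *+ M.+1) =
  (1 - 'X^(M.+1)) * (qpoch M * lambert N M) + qpoch M * 'X^(M.+1) *+ M.+1
   - 'X^(M.+1) ^+ N.+1 * (qpoch M *+ M.+1).
  transitivity ((1 - 'X^(M.+1)) * (qpoch M * lambert N M) +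
     qpoch M * ((1 - 'X^(M.+1)) * G) *+ M.+1).
    by ring.
  by rewrite hG; ring.
have -> : - ('X * ((qpoch M)^`() * (1 - 'X^(M.+1)) + qpoch M * - ('X^(M.+1.-1) *+ M.+1))) =
  (1 - 'X^(M.+1)) * - ('X * (qpoch M)^`()) + qpoch M * 'X^(M.+1) *+ M.+1 - 0.
  by rewrite /= exprS; ring.
apply: eqmXB; last by rewrite -exprM; apply: eqmX_Xn0; lia.
by apply: eqmXD => //; apply: eqmXM.
Qed.

Definition sumsq (l : nat) : nat := \sum_(1 <= i < l.+1) i ^ 2.

Lemma sumsqS l : sumsq l.+1 = (sumsq l + l.+1 ^ 2)%N.
Proof. by rewrite /sumsq big_nat_recr. Qed.

Lemma sumsq_triang l : (3 * sumsq l = (2 * l).+1 * triang l)%N.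
Proof.
elim: l => [|l IH]; first by rewrite /sumsq big_geq.
rewrite sumsqS triangS mulnDr IH; have := triang_double l; lia.
Qed.

(* The logarithmic derivative of [qpoch ^+ 3] is [-3] times the generating series
   of [sigma], so Jacobi's identity becomes a recurrence for [sigma]. *)
Lemma jacobi_lambert N :
  eqmX N.+1 (jacobi_series N * lambert N N)
    (- \sum_(0 <= l < N.+1) (-1) ^+ l * 'X^(triang l) *+ sumsq l).
Proof.
set S := \sum_(_ <= _ < _) _.
(* This rests on [(2l + 1) triang l = 3 sumsq l]; the factor 3 cancels the exponent of the cube. *)
have hd : 'X * (jacobi_series N)^`() = S *+ 3.
  rewrite /jacobi_series raddf_sum mulr_sumr /S -sumrMnl; apply: eq_bigr => l _ /=.
  rewrite -[RHS]mulrnA [(_ * 3)%N]mulnC sumsq_triang [((2 * l).+1 * _)%N]mulnC mulrnA.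
  rewrite derivMn mulrnAr; congr (_ *+ _).
  rewrite -(rmorph_sign polyC) mul_polyC derivZ derivXn -scalerAr mulrnAr -exprS.
  by rewrite scalerMnr; case: (triang l).
have hc := @jacobi_cube N.
have h3 : eqmX N.+1 (jacobi_series N * lambert N N *+ 3) (- S *+ 3).
  rewrite mulNrn -hd.
  apply: (@eqmX_trans _ _ (qpoch N ^+ 2 * (qpoch N * lambert N N) *+ 3)).
    by rewrite mulrA -exprSr; apply: eqmXMn; apply: eqmXM.
  apply: (@eqmX_trans _ _ (- ('X * (qpoch N ^+ 3)^`()))); last first.
    by apply: eqmXN; apply: eqmX_XderivM; apply: eqmX_sym.
  rewrite deriv_exp /=.
  have -> : - ('X * ((qpoch N)^`() * qpoch N ^+ 2 *+ 3)) =
     qpoch N ^+ 2 * (- ('X * (qpoch N)^`())) *+ 3 by ring.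
  by apply: eqmXMn; apply: eqmXM => //; apply: qpoch_lambert.
move=> i lin; have := h3 i lin; rewrite !coefMn => /eqP.
by rewrite eqrMn2r // => /eqP.
Qed.

(** * The fixed-point system and its solution modulo t^4 *)

Definition altsum (K : comNzRingType) (a : nat -> K) (q w : K) (N : nat) : K :=
  \sum_(1 <= l < N.+1) (-1) ^+ l * a l * q ^+ triang l * w ^+ l.

Definition wstep (K : comNzRingType) (a b : nat -> K) (q w v : K) (N : nat) : K :=
  1 + altsum b q v N - w * altsum a q w N.

(* [sol N a b] and [sol N b a] are the N-th approximations of the solution (w, v) of
   [w = 1 + S_b v - w * S_a w] and [v = 1 + S_a w - v * S_b v],
   where [S_a w = \sum_(l >= 1) (-1)^l a_l X^(l(l+1)/2) w^l]; the solution has [w * v = 1]. *)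
Fixpoint sol (K : comNzRingType) (N : nat) (a b : nat -> K) : {poly K} :=
  if N is N'.+1 then
    wstep (fun l => (a l)%:P) (fun l => (b l)%:P) 'X (sol N' a b) (sol N' b a) N
  else 1.

Section Stability.
Variable K : comNzRingType.
Implicit Types (a b : nat -> {poly K}) (w v : {poly K}).

Lemma altsum_eqmX1 a w N : eqmX 1 (altsum a 'X w N) 0.
Proof.
rewrite /altsum big_nat -[X in eqmX _ _ X](@big1 _ 0 +%R _ (index_iota 1 N.+1)
  (fun i => (0 < i < N.+1)%N) (fun=> 0)) //.
apply: eqmX_sum => l /andP[l0 _]; rewrite -mulrA [_ * ('X^_ * _)]mulrCA.
by apply: eqmX_Xn0; apply: leq_trans (leq_triang l).
Qed.

Lemma altsum_eqmX a w w' n N : eqmX n w w' -> (n <= N)%N ->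
  eqmX n.+1 (altsum a 'X w N) (altsum a 'X w' n).
Proof.
move=> hw nN; rewrite /altsum (big_cat_nat _ (n := n.+1)) //=.
rewrite -[X in eqmX _ _ X]addr0; apply: eqmXD.
  rewrite !big_nat; apply: eqmX_sum => l /andP[l0 _].
  rewrite -!mulrA; apply: eqmXM => //; rewrite !['X^_ * _]mulrC !mulrA !(mulrC _ 'X^_).
  have : (n.+1 <= triang l + n)%N by have := leq_trans l0 (leq_triang l); lia.
  move/eqmX_leq; apply; apply: eqmX_mulXn; apply: eqmXM => //; exact: eqmXX.
rewrite big_nat -[X in eqmX _ _ X](@big1 _ 0 +%R _ (index_iota n.+1 N.+1)
  (fun i => (n < i < N.+1)%N) (fun=> 0)) //.
apply: eqmX_sum => l /andP[l0 _]; rewrite -mulrA [_ * ('X^_ * _)]mulrCA.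
by apply: eqmX_Xn0; apply: leq_trans (leq_triang l).
Qed.

(** Contraction in the X-adic sense: the l-th summand carries [X^(triang l)] with
    [triang l >= l >= 1], so a step gains one coefficient, and summands with [l > n] are invisible
    whatever the two cut-offs. *)
Lemma wstep_eqmX a b w w' v v' n N N' : (n <= N)%N -> (n <= N')%N ->
  eqmX n w w' -> eqmX n v v' -> eqmX n.+1 (wstep a b 'X w v N) (wstep a b 'X w' v' N').
Proof.
move=> nN nN' hw hv.
have hs (c : nat -> {poly K}) (x x' : {poly K}) : eqmX n x x' ->
    eqmX n.+1 (altsum c 'X x N) (altsum c 'X x' N').
  move=> hx; apply: (@eqmX_trans _ _ (altsum c 'X x' n)); first exact: altsum_eqmX.
  by apply: eqmX_sym; apply: altsum_eqmX.
rewrite /wstep; apply: eqmXB; first by apply: eqmXD => //; apply: hs.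
apply/eqmX_subr0.
have -> : w * altsum a 'X w N - w' * altsum a 'X w' N' =
  (w - w') * altsum a 'X w N + w' * (altsum a 'X w N - altsum a 'X w' N') by ring.
rewrite -[X in eqmX _ _ X]addr0; apply: eqmXD.
  rewrite -addn1; apply: eqmX_mul0; first by apply/eqmX_subr0.
  exact: altsum_eqmX1.
rewrite -(mulr0 w'); apply: eqmXM => //; apply/eqmX_subr0; exact: hs.
Qed.

End Stability.

(** Hence the n-th coefficient of [sol n a b] is already that of the limit series. The base case
    reads [1] as a step from the pair [(1, 1)] without summands. *)
Lemma sol_stable (K : comNzRingType) (a b : nat -> K) N M :
  (N <= M)%N -> eqmX N.+1 (sol M a b) (sol N a b).
Proof.
elim: N M a b => [|N IH] [|M] a b //= leNM; last by apply: wstep_eqmX => //; apply: IH.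
apply: (@eqmX_trans _ _ (wstep (fun l => (a l)%:P) (fun l => (b l)%:P) 'X 1 1 0)).
  exact: wstep_eqmX.
by rewrite /wstep /altsum !big_geq // addr0 mulr0 subr0.
Qed.

(** * Expansion of the two products when [t^4 = 0] *)

Section Nilpotent.
Variables (K : comNzRingType) (t : K).
Hypothesis t4 : t ^+ 4 = 0.

(** When [t^4 = 0] the truncated geometric series inverts [1 + i t], so this is [A_l] without
    division. *)
Definition invfac_trunc (l : nat) : K :=
  \prod_(1 <= i < l.+1) (1 - i%:R * t + (i%:R * t) ^+ 2 - (i%:R * t) ^+ 3).

Definition lowfac (F : comNzRingType) (s : F) (l : nat) : F :=
  \prod_(1 <= i < l.+1) (1 - i%:R * s).

Lemma lowfacS (F : comNzRingType) (s : F) l :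
  lowfac s l.+1 = lowfac s l * (1 - l.+1%:R * s).
Proof. by rewrite /lowfac big_nat_recr. Qed.

Lemma invfac_truncS l : invfac_trunc l.+1 = invfac_trunc l *
  (1 - l.+1%:R * t + (l.+1%:R * t) ^+ 2 - (l.+1%:R * t) ^+ 3).
Proof. by rewrite /invfac_trunc big_nat_recr. Qed.

Lemma t2_lowfac l : t ^+ 2 * lowfac t l = t ^+ 2 * (1 - (triang l)%:R * t).
Proof.
elim: l => [|l IH]; first by rewrite /lowfac big_geq // triang0 mul0r subr0.
rewrite lowfacS mulrA IH triangS natrD; set T := _%:R; set L := _%:R.
transitivity (t ^+ 2 * (1 - (T + L) * t) + T * L * t ^+ 4); first by ring.
by rewrite t4 mulr0 addr0.
Qed.

(** The quotient of the two products is [\prod (1 - i^2 t^2)^-1], that is, [1 + (sumsq l) t^2]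
    modulo [t^4]; in front of [t^2] only the part [1 - (triang l) t] of [lowfac t l] survives. *)
Lemma invfac_lowfac l :
  invfac_trunc l = lowfac t l + (sumsq l)%:R * t ^+ 2 * (1 - (triang l)%:R * t).
Proof.
elim: l => [|l IH].
  by rewrite /lowfac /invfac_trunc /sumsq !big_geq // mul0r mul0r addr0.
have h2 := t2_lowfac l.
rewrite invfac_truncS lowfacS IH sumsqS triangS (natrD _ (sumsq l)) (natrD _ (triang l)) natrX.
move: h2 {IH}; set T := (triang l)%:R; set L := _.+1%:R; set S := (sumsq l)%:R.
move: (lowfac t l) => c h2.
transitivity (c * (1 - L * t) + S * (t ^+ 2 * (1 - T * t) - L * t * t ^+ 2) +
   (t ^+ 2 * c) * (L ^+ 2 - L ^+ 3 * t) + t ^+ 4 * (S * T * L + S * L ^+ 2 -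
   (S * L ^+ 3 + S * T * L ^+ 2) * t + S * T * L ^+ 3 * t ^+ 2)); first by ring.
rewrite h2.
transitivity (c * (1 - L * t) + (S + L ^+ 2) * t ^+ 2 * (1 - (T + L) * t) +
   t ^+ 4 * (S * T * L + S * L ^+ 2 - (S * L ^+ 3 + S * T * L ^+ 2) * t +
   S * T * L ^+ 3 * t ^+ 2 + T * L ^+ 3)); first by ring.
by rewrite t4 mul0r addr0.
Qed.

End Nilpotent.

Lemma eqmX_map (K L : comNzRingType) (f : {rmorphism K -> L}) n (p q : {poly K}) :
  eqmX n p q -> eqmX n (map_poly f p) (map_poly f q).
Proof. by move=> h i lin; rewrite !coef_map h. Qed.

Section NilpotentSolution.
Variables (K : comNzRingType) (t : K).
Hypothesis t4 : t ^+ 4 = 0.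

Definition lambertK (M : nat) : {poly K} := map_poly intr (lambert M M).

Definition correction (M : nat) : {poly K} :=
  lambertK M - t%:P * ('X * (lambertK M)^`()).

Let tP4 : t%:P ^+ 4 = 0.
Proof. by rewrite -polyC_exp t4. Qed.

Let e (l : nat) : {poly K} := (-1) ^+ l * 'X^(triang l).

Let th_e l : 'X * (e l)^`() = (triang l)%:R * e l.
Proof.
rewrite /e -(rmorph_sign polyC) mul_polyC derivZ derivXn -scalerAr mulrnAr -exprS.
by rewrite mulr_natl scalerMnr; case: (triang l).
Qed.

Let map_e l : map_poly intr ((-1) ^+ l * 'X^(triang l) : {poly int}) = e l.
Proof. by rewrite rmorphM /= rmorph_sign map_polyXn. Qed.

(** This is the system linearized around [w = v = 1]; the isolated term is the summand [l = 0]. With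
    [theta = X d/dX] and [P], [J], [U] as in the proof, the left side is
    [(t^2 - t^3 theta) (P + J U)], and [P + J U] vanishes by [jacobi_lambert]. The shape
    [U - t theta U] of the correction is what turns the [t^3] part into a derivative. *)
Lemma correction_eqmX M :
  eqmX M.+1 (t%:P ^+ 2 * correction M + \sum_(1 <= l < M.+1)
     e l * (t%:P ^+ 2 * (1 - (triang l)%:R * t%:P)) *
     ((sumsq l)%:R + (2 * l).+1%:R * correction M)) 0.
Proof.
set U := lambertK M; set z := t%:P; set D := 'X * U^`().
have z4 : z ^+ 4 = 0 by exact: tP4.
pose J : {poly K} := \sum_(0 <= l < M.+1) (2 * l).+1%:R * e l.
pose P : {poly K} := \sum_(0 <= l < M.+1) (sumsq l)%:R * e l.
have hJU : eqmX M.+1 (P + J * U) 0.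
  have := eqmX_map (intr : {rmorphism int -> K}) (@jacobi_lambert M).
  rewrite rmorphM rmorphN /=.
  have -> : map_poly intr (jacobi_series M) = J.
    rewrite /jacobi_series rmorph_sum /=.
    by apply: eq_bigr => l _; rewrite rmorphMn /= map_e mulr_natl.
  have -> : map_poly intr (\sum_(0 <= l < M.+1) (-1) ^+ l * 'X^(triang l) *+ sumsq l) = P.
    by rewrite rmorph_sum; apply: eq_bigr => l _; rewrite rmorphMn /= map_e mulr_natl.
  by move=> h; rewrite -(subrr P) -[P - P]addrC addrC; apply: eqmXD => //; rewrite opprK.
have -> : z ^+ 2 * correction M + \sum_(1 <= l < M.+1)
     e l * (z ^+ 2 * (1 - (triang l)%:R * z)) * ((sumsq l)%:R + (2 * l).+1%:R * correction M)
  = \sum_(0 <= l < M.+1)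
     e l * (z ^+ 2 * (1 - (triang l)%:R * z)) * ((sumsq l)%:R + (2 * l).+1%:R * correction M).
  rewrite [RHS]big_ltn //; congr (_ + _).
  by rewrite /e /sumsq big_geq // triang0 mul0r subr0 muln0 !mul1r mulr1 add0r.
have -> : \sum_(0 <= l < M.+1) e l * (z ^+ 2 * (1 - (triang l)%:R * z)) *
     ((sumsq l)%:R + (2 * l).+1%:R * correction M) =
  z ^+ 2 * (P + J * U) - z ^+ 3 * ('X * (P + J * U)^`()).
  have thsum (c : nat -> nat) : 'X * (\sum_(0 <= l < M.+1) (c l)%:R * e l)^`() =
      \sum_(0 <= l < M.+1) (c l)%:R * ((triang l)%:R * e l).
    rewrite raddf_sum mulr_sumr; apply: eq_bigr => l _ /=.
    by rewrite mulr_natl derivMn mulrnAr th_e [RHS]mulr_natl.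
  have hY : correction M = U - z * D by [].
  have -> : 'X * (P + J * U)^`() = 'X * P^`() + ('X * J^`() * U + J * D).
    by rewrite derivD derivM /D; ring.
  rewrite /P /J !thsum hY; move: U D {hY hJU J P thsum} => U D.
  set V := \sum_(_ <= _ < _) _; set P := \sum_(_ <= _ < _) _; set J := \sum_(_ <= _ < _) _.
  set thP := \sum_(_ <= _ < _) _; set thJ := \sum_(_ <= _ < _) _.
  suff -> : V = z ^+ 2 * (P + J * U) - z ^+ 3 * (thP + (thJ * U + J * D)) +
      z ^+ 4 * (thJ * D) by rewrite z4 mul0r addr0.
  rewrite /V /P /J /thP /thJ.
  elim: M.+1 => [|n IH]; first by rewrite !big_geq //; ring.
  by rewrite !big_nat_recr //= IH; ring.
rewrite -[X in eqmX _ _ X]subr0; apply: eqmXB.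
  by rewrite -(mulr0 (z ^+ 2)); apply: eqmXM.
rewrite -(mulr0 (z ^+ 3)); apply: eqmXM => //.
by rewrite -(mulr0 'X) -(@deriv0 K); apply: eqmX_XderivM.
Qed.

Lemma t2_expr1D (c : {poly K}) n :
  (1 + t%:P ^+ 2 * c) ^+ n = 1 + n%:R * (t%:P ^+ 2 * c).
Proof.
elim: n => [|n IH]; first by rewrite mul0r addr0.
rewrite exprS IH -natr1.
transitivity (1 + (n%:R + 1) * (t%:P ^+ 2 * c) + t%:P ^+ 4 * c ^+ 2 * n%:R); first by ring.
by rewrite tP4 !mul0r addr0.
Qed.

Let a l := (invfac_trunc t l)%:P.
Let b l := (lowfac t l)%:P.

Let t2b l : t%:P ^+ 2 * b l = t%:P ^+ 2 * (1 - (triang l)%:R * t%:P).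
Proof. 
by rewrite /b -polyC_exp -polyCM t2_lowfac // !rmorphM rmorphB rmorph1 rmorphM /= polyC_natr. Qed.

Let ab l : a l = b l + (sumsq l)%:R * (t%:P ^+ 2 * (1 - (triang l)%:R * t%:P)).
Proof.
rewrite /a invfac_lowfac // polyCD; congr (_ + _).
by rewrite -mulrA !(rmorphM, rmorphB, rmorph1, rmorph_nat, polyC_exp).
Qed.

(** Powers of [1 + t^2 Y] and [1 - t^2 Y] are linear in [t^2 Y], so this is the l-th summand of
    [w S_a w - S_b v], stripped of its sign and power of [X]. *)
Let term_identity l (Y : {poly K}) :
  a l * (1 + (l.+1)%:R * (t%:P ^+ 2 * Y)) - b l * (1 - l%:R * (t%:P ^+ 2 * Y)) =
  t%:P ^+ 2 * (1 - (triang l)%:R * t%:P) * ((sumsq l)%:R + (2 * l).+1%:R * Y).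
Proof.
have h := t2b l; rewrite ab; move: (b l) h => c h; set S := (sumsq l)%:R.
set T := (triang l)%:R in h *; set z := t%:P in h *.
have z4 : z ^+ 4 = 0 by exact: tP4.
have e1 : l.+1%:R = l%:R + 1 :> {poly K} by rewrite natr1.
have e2 : (2 * l).+1%:R = l%:R + l%:R + 1 :> {poly K} by rewrite -natrD natr1 addnn mul2n.
rewrite e1 e2; move: (l%:R) => L.
transitivity (S * (z ^+ 2 * (1 - T * z)) + (z ^+ 2 * c) * ((L + L + 1) * Y) +
   z ^+ 4 * (S * (1 - T * z) * (L + 1) * Y)); first by ring.
by rewrite h z4; ring.
Qed.

Let t2_opp (Y : {poly K}) : 1 - t%:P ^+ 2 * Y = 1 + t%:P ^+ 2 * (- Y).
Proof. by rewrite mulrN. Qed.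

Lemma wstep_fixed_up M :
  eqmX M.+1 (wstep a b 'X (1 + t%:P ^+ 2 * correction M) (1 - t%:P ^+ 2 * correction M) M)
     (1 + t%:P ^+ 2 * correction M).
Proof.
have := @correction_eqmX M; set Y := correction M => h.
apply/eqmX_subr0; rewrite -[X in eqmX _ _ X]oppr0.
set G := \sum_(_ <= _ < _) _ in h.
suff -> : wstep a b 'X (1 + t%:P ^+ 2 * Y) (1 - t%:P ^+ 2 * Y) M - (1 + t%:P ^+ 2 * Y) =
  - (t%:P ^+ 2 * Y + G) by apply: eqmXN.
rewrite /wstep; suff -> : G = (1 + t%:P ^+ 2 * Y) * altsum a 'X (1 + t%:P ^+ 2 * Y) M
   - altsum b 'X (1 - t%:P ^+ 2 * Y) M by ring.
rewrite /altsum mulr_sumr -sumrB; apply: eq_bigr => l _.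
rewrite -mulrA -term_identity [X in _ = X - _]mulrCA -[X in _ = _ * X - _]exprS.
rewrite [in RHS]t2_opp !t2_expr1D !mulrN /e.
by ring.
Qed.

Lemma wstep_fixed_down M :
  eqmX M.+1 (wstep b a 'X (1 - t%:P ^+ 2 * correction M) (1 + t%:P ^+ 2 * correction M) M)
     (1 - t%:P ^+ 2 * correction M).
Proof.
have := @correction_eqmX M; set Y := correction M => h.
apply/eqmX_subr0; set G := \sum_(_ <= _ < _) _ in h.
suff -> : wstep b a 'X (1 - t%:P ^+ 2 * Y) (1 + t%:P ^+ 2 * Y) M - (1 - t%:P ^+ 2 * Y) =
  (t%:P ^+ 2 * Y + G) by [].
rewrite /wstep; suff -> : G = altsum a 'X (1 + t%:P ^+ 2 * Y) M
   - (1 - t%:P ^+ 2 * Y) * altsum b 'X (1 - t%:P ^+ 2 * Y) M by ring.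
rewrite /altsum mulr_sumr -sumrB; apply: eq_bigr => l _.
rewrite -mulrA -term_identity t2_expr1D /e.
have -> : (1 - t%:P ^+ 2 * Y) * ((-1) ^+ l * b l * 'X^(triang l) * (1 - t%:P ^+ 2 * Y) ^+ l) =
  (-1) ^+ l * b l * 'X^(triang l) * (1 - l.+1%:R * (t%:P ^+ 2 * Y)).
  by rewrite [LHS]mulrCA -[X in _ * X]exprS t2_opp t2_expr1D !mulrN.
rewrite -natr1; set T := 'X^_; set s := (-1) ^+ l; set z := t%:P ^+ 2 * Y; set L := l%:R.
(* Both [z] and [a l - b l] are multiples of [t^2]. The linearized summands of the two equations
   differ by [z * (a l - b l)], so they coincide. *)
have h2 : z * a l = z * b l.
  rewrite ab mulrDr; set S := (sumsq l)%:R; set R := 1 - _.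
  transitivity (z * b l + t%:P ^+ 4 * (Y * S * R)); first by rewrite /z; ring.
  by rewrite tP4 mul0r addr0.
transitivity (s * T * (a l - b l + L * (z * a l) + (z * a l) + L * (z * b l))); first by ring.
by rewrite [X in _ + X + _]h2; ring.
Qed.

(** Uniqueness of the fixed point: a step applied to the iterates and to the explicit pair gains one
    coefficient of agreement. [M] stays fixed because the correction depends on its own cut-off. *)
Lemma sol_nilpotent M N : (N <= M)%N ->
  eqmX N.+1 (sol N (invfac_trunc t) (lowfac t)) (1 + t%:P ^+ 2 * correction M) /\
  eqmX N.+1 (sol N (lowfac t) (invfac_trunc t)) (1 - t%:P ^+ 2 * correction M).
Proof.
elim: N => [_|N IH leNM].
  have e1 (c d : nat -> {poly K}) : 1 = wstep c d 'X 1 1 0.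
    by rewrite /wstep /altsum !big_geq // addr0 mulr0 subr0.
  split=> /=.
    apply: (@eqmX_trans _ _ (wstep a b 'X (1 + t%:P ^+ 2 * correction M)
      (1 - t%:P ^+ 2 * correction M) M)).
      by rewrite [X in eqmX _ X](e1 a b); apply: wstep_eqmX.
    by apply: eqmX_leq (@wstep_fixed_up M).
  apply: (@eqmX_trans _ _ (wstep b a 'X (1 - t%:P ^+ 2 * correction M)
    (1 + t%:P ^+ 2 * correction M) M)).
    by rewrite [X in eqmX _ X](e1 b a); apply: wstep_eqmX.
  by apply: eqmX_leq (@wstep_fixed_down M).
have [h1 h2] := IH (ltnW leNM); split=> /=.
  apply: (@eqmX_trans _ _ (wstep a b 'X (1 + t%:P ^+ 2 * correction M)
    (1 - t%:P ^+ 2 * correction M) M)); first exact: wstep_eqmX.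
  by apply: eqmX_leq (@wstep_fixed_up M).
apply: (@eqmX_trans _ _ (wstep b a 'X (1 - t%:P ^+ 2 * correction M)
  (1 + t%:P ^+ 2 * correction M) M)); first exact: wstep_eqmX.
by apply: eqmX_leq (@wstep_fixed_down M).
Qed.

Lemma correction_coef M n : (0 < n <= M)%N ->
  (t%:P ^+ 2 * correction M)`_n = (sigma n)%:R * (t ^+ 2 - n%:R * t ^+ 3).
Proof.
move=> hn; have hl := lambert_coef hn.
rewrite -polyC_exp mul_polyC coefZ coefB mul_polyC coefZ coefXM.
case: n hn hl => // n _ hl; rewrite coef_deriv /= /lambertK coef_map hl /=.
by rewrite -pmulrn -mulr_natr; ring.
Qed.

End NilpotentSolution.

(** * Rationality of the coefficients *)

Definition linprod (L : nat) (e : nat -> nat) : {poly int} :=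
  \prod_(1 <= l < L.+1) (1 + l%:R * 'X) ^+ e l.

Lemma linprodS L e : linprod L.+1 e = linprod L e * (1 + L.+1%:R * 'X) ^+ e L.+1.
Proof. by rewrite /linprod big_nat_recr. Qed.

Lemma linprodM L e e' : linprod L e * linprod L e' = linprod L (fun l => e l + e' l)%N.
Proof. by rewrite -big_split; apply: eq_bigr => l _; rewrite exprD. Qed.

Lemma eq_linprod L e e' : (forall l, (0 < l <= L)%N -> e l = e' l) ->
  linprod L e = linprod L e'.
Proof.
by move=> h; rewrite /linprod !big_nat; apply: eq_bigr => l hl; rewrite h.
Qed.

Lemma linprod_widen L L' e : (L <= L')%N -> (forall l, (L < l)%N -> e l = 0%N) ->
  linprod L' e = linprod L e.
Proof.
move=> leL h; rewrite /linprod (big_cat_nat _ (n := L.+1)) //= [X in _ * X]big_nat.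
by rewrite [X in _ * X]big1 ?mulr1 // => l /andP[/h ->].
Qed.

Lemma size_linear_factor (c : int) : (size (1 + c *: 'X)%R <= 2)%N.
Proof.
rewrite (leq_trans (size_polyD _ _)) // size_poly1 geq_max /=.
by rewrite (leq_trans (size_scale_leq _ _)) // size_polyX.
Qed.

Lemma size_linprod L e : (size (linprod L e) <= (\sum_(1 <= l < L.+1) e l).+1)%N.
Proof.
elim: L => [|L IH]; first by rewrite /linprod !big_geq // size_poly1.
rewrite linprodS big_nat_recr //= (leq_trans (size_polyMleq _ _)) //.
have h : (size ((1 + L.+1%:R * 'X) ^+ e L.+1 : {poly int})%R <= (e L.+1).+1)%N.
  rewrite (leq_trans (size_poly_exp_leq _ _)) // ltnS mulr_natl -scaler_nat.
  by have := size_linear_factor (L.+1%:R); case: (size _) => [|[|[|?]]] //=; lia.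
by rewrite -subn1 leq_subLR add1n (leq_trans (leq_add IH h)) // addSn addnS.
Qed.

Lemma linprod_coef0 L e : (linprod L e)`_0 = 1.
Proof.
rewrite -horner_coef0 /linprod horner_prod big1 // => l _.
by rewrite horner_exp hornerD hornerM hornerX mulr0 hornerC addr0 expr1n.
Qed.

Lemma linprod_coef1 L e : (linprod L e)`_1 = (\sum_(1 <= l < L.+1) l * e l)%N%:R.
Proof.
elim: L => [|L IH]; first by rewrite /linprod !big_geq // coef1.
rewrite linprodS big_nat_recr //= coefM big_ord_recr big_ord_recl big_ord0 /= subnn addr0.
rewrite IH linprod_coef0 mul1r natrD addrC; congr (_ + _).
  have h : ((1 + L.+1%:R * 'X) ^+ e L.+1 : {poly int})`_0 = 1.
    by rewrite -horner_coef0 horner_exp hornerD hornerM hornerX mulr0 hornerC addr0 expr1n.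
  by rewrite h mulr1.
have c1 n : ((1 + L.+1%:R * 'X) ^+ n : {poly int})`_0 = 1.
  by rewrite -horner_coef0 horner_exp hornerD hornerM hornerX mulr0 hornerC addr0 expr1n.
rewrite subn0; elim: (e _) => [|n IHn]; first by rewrite expr0 coef1 muln0.
rewrite exprS coefM big_ord_recr big_ord_recl big_ord0 /= subnn subn0 addr0 c1 IHn mulr1.
rewrite coefD coef1 coefD coef1 /= !mulr_natl !coefMn !coefX /= mul0rn addr0 mul1r add0r.
by rewrite mulnS natrD addrC.
Qed.

Lemma gam_gt n l : (n < l)%N -> gam n l = 0%N.
Proof. by move=> lt; rewrite /gam divn_small //; nia. Qed.

Lemma gam_superadd i j l : (gam i l + gam j l <= gam (i + j) l)%N.
Proof.
case: l => [|l]; first by rewrite /gam mul0n !divn0.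
by rewrite /gam leq_divRL // mulnDl mulnDr leq_add // leq_divM.
Qed.

Lemma gam_triang l i : (0 < i <= l)%N -> (0 < gam (triang l) i)%N.
Proof.
move=> /andP[i0 il]; rewrite /gam divn_gt0; last by nia.
by rewrite triang_double; nia.
Qed.

(** The reciprocal polynomial: its value at [1/k] is [Q_n(k) / k^(M_n)], so expansions at infinite
    [k] become expansions at 0. *)
Definition Qrev (n : nat) : {poly int} := linprod n (gam n).

Lemma QrevE n L : (n <= L)%N -> Qrev n = linprod L (gam n).
Proof. by move=> h; rewrite (linprod_widen h) // => l /gam_gt. Qed.

Lemma mu0E n L : (n <= L)%N -> mu 0 n = (\sum_(1 <= l < L.+1) gam n l)%N.
Proof.
move=> leL; rewrite /mu [RHS](big_cat_nat _ (n := n.+1)) //= [X in (_ + X)%N]big_nat.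
rewrite [X in (_ + X)%N]big1 ?addn0 => [|l /andP[/gam_gt //]].
by apply: eq_bigr => l _; rewrite expn0 mul1n.
Qed.

(** Floors are superadditive. The size of the cofactor [E] is recorded because it keeps numerators
    within degree [M_n] when coefficients are multiplied. *)
Lemma Qrev_superadd i j : exists2 E : {poly int},
  Qrev (i + j) = Qrev i * Qrev j * E & (size E + mu 0 i + mu 0 j <= (mu 0 (i + j)).+1)%N.
Proof.
exists (linprod (i + j) (fun l => gam (i + j) l - (gam i l + gam j l))%N).
  rewrite (@QrevE i (i + j)) ?leq_addr // (@QrevE j (i + j)) ?leq_addl // !linprodM.
  by apply: eq_linprod => l _; rewrite subnKC // gam_superadd.
rewrite -addnA (@mu0E i (i + j)) ?leq_addr // (@mu0E j (i + j)) ?leq_addl //.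
rewrite -big_split /= (@mu0E (i + j) (i + j)) //.
apply: leq_trans (leq_add (size_linprod _ _) (leqnn _)) _; rewrite addSn ltnS -big_split.
by apply: leq_sum => l _ /=; rewrite subnK // gam_superadd.
Qed.

(** * Passing rational coefficients through the recursion *)

Section RationalCoefficients.
Variables (R : numFieldType) (K : comNzRingType) (phi : {rmorphism {poly int} -> K}).
Hypothesis phiX4 : phi 'X ^+ 4 = 0.
Implicit Types (c : nat -> R) (s : K).

Definition evinv (k : nat) (p : {poly int}) : R := (map_poly intr p).[k%:R^-1].

Lemma evinvM k p q : evinv k (p * q) = evinv k p * evinv k q.
Proof. by rewrite /evinv rmorphM hornerM. Qed.

Lemma evinvD k p q : evinv k (p + q) = evinv k p + evinv k q.
Proof. by rewrite /evinv rmorphD hornerD. Qed.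

(* The n-th coefficients of the solution, as functions of [k], have the form
   [P(1/k) / Qrev n (1/k)]; [s] records the expansion of this at [1/k = 0] up to order 3. *)
Definition ratcoef (n : nat) (c : nat -> R) (s : K) := exists P : {poly int},
  [/\ (size P <= (n + mu 0 n).+1)%N,
      forall k, (0 < k)%N -> c k * evinv k (Qrev n) = evinv k P
    & phi P = phi (Qrev n) * s].

Lemma ratcoef_ext n c c' s : (forall k, (0 < k)%N -> c k = c' k) ->
  ratcoef n c s -> ratcoef n c' s.
Proof. by move=> h [P [h1 h2 h3]]; exists P; split=> // k k0; rewrite -h // h2. Qed.

Lemma ratcoef0 n : ratcoef n (fun=> 0) 0.
Proof.
exists 0; split; first by rewrite size_poly0.
- by move=> k _; rewrite mul0r /evinv rmorph0 horner0.
- by rewrite rmorph0 mulr0.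
Qed.

Lemma ratcoef1 : ratcoef 0 (fun=> 1) 1.
Proof.
exists 1; split; first by rewrite size_poly1.
- by move=> k _; rewrite mul1r /Qrev /linprod big_geq.
- by rewrite /Qrev /linprod big_geq // mulr1.
Qed.

Lemma ratcoefD n c c' s s' : ratcoef n c s -> ratcoef n c' s' ->
  ratcoef n (fun k => c k + c' k) (s + s').
Proof.
move=> [P [h1 h2 h3]] [P' [h1' h2' h3']]; exists (P + P'); split.
- by rewrite (leq_trans (size_polyD _ _)) // geq_max h1 h1'.
- by move=> k k0; rewrite mulrDl h2 // h2' // evinvD.
- by rewrite rmorphD h3 h3' mulrDr.
Qed.

Lemma ratcoefN n c s : ratcoef n c s -> ratcoef n (fun k => - c k) (- s).
Proof.
move=> [P [h1 h2 h3]]; exists (- P); split; first by rewrite size_polyN.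
- by move=> k k0; rewrite mulNr h2 // /evinv rmorphN hornerN.
- by rewrite rmorphN h3 mulrN.
Qed.

Lemma ratcoefM i j c c' s s' : ratcoef i c s -> ratcoef j c' s' ->
  ratcoef (i + j) (fun k => c k * c' k) (s * s').
Proof.
move=> [P [h1 h2 h3]] [P' [h1' h2' h3']].
have [E eQ sE] := Qrev_superadd i j; exists (P * P' * E); split.
- rewrite (leq_trans (size_polyMleq _ _)) //.
  have := size_polyMleq P P'; move: h1 h1' sE; lia.
- by move=> k k0; rewrite eQ !evinvM -h2 // -h2' //; ring.
- by rewrite eQ !rmorphM h3 h3'; ring.
Qed.

Lemma ratcoef_sum n (I : Type) (r : seq I) (P : pred I) (c : I -> nat -> R) (s : I -> K) :
  (forall i, P i -> ratcoef n (c i) (s i)) ->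
  ratcoef n (fun k => \sum_(i <- r | P i) c i k) (\sum_(i <- r | P i) s i).
Proof.
move=> h; elim: r => [|i r IH].
  by rewrite big_nil; apply: ratcoef_ext (ratcoef0 n) => k _; rewrite big_nil.
rewrite big_cons; case: ifP => Pi.
  by apply: ratcoef_ext (ratcoefD (h _ Pi) IH) => k _; rewrite big_cons Pi.
by apply: ratcoef_ext IH => k _; rewrite big_cons Pi.
Qed.

Definition ratpoly (F : nat -> {poly R}) (G : {poly K}) :=
  forall n, ratcoef n (fun k => (F k)`_n) G`_n.

Lemma ratpolyD F F' G G' : ratpoly F G -> ratpoly F' G' ->
  ratpoly (fun k => F k + F' k) (G + G').
Proof.
move=> h h' n; rewrite coefD; apply: ratcoef_ext (ratcoefD (h n) (h' n)) => k _.
by rewrite coefD.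
Qed.

Lemma ratpolyN F G : ratpoly F G -> ratpoly (fun k => - F k) (- G).
Proof. by move=> h n; rewrite coefN; apply: ratcoef_ext (ratcoefN (h n)) => k _; rewrite coefN. Qed.

Lemma ratpolyM F F' G G' : ratpoly F G -> ratpoly F' G' ->
  ratpoly (fun k => F k * F' k) (G * G').
Proof.
move=> h h' n; rewrite coefM.
apply: (@ratcoef_ext _ (fun k => \sum_(j < n.+1) (F k)`_j * (F' k)`_(n - j))) => [k _|].
  by rewrite coefM.
apply: ratcoef_sum => j _.
by have := ratcoefM (h j) (h' (n - j)%N); rewrite subnKC // -ltnS.
Qed.

Lemma ratpoly1 : ratpoly (fun=> 1) 1.
Proof.
by case=> [|n]; rewrite !coef1; [exact: ratcoef1|exact: ratcoef0].
Qed.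

Lemma ratpolyX F G m : ratpoly F G -> ratpoly (fun k => F k ^+ m) (G ^+ m).
Proof.
move=> h; elim: m => [|m IH]; first by rewrite expr0; exact: ratpoly1.
rewrite exprS => n; apply: ratcoef_ext (ratpolyM h IH n) => k _.
by rewrite exprS.
Qed.

Lemma ratpoly_sum (I : Type) (r : seq I) (F : I -> nat -> {poly R}) (G : I -> {poly K}) :
  (forall i, ratpoly (F i) (G i)) ->
  ratpoly (fun k => \sum_(i <- r) F i k) (\sum_(i <- r) G i).
Proof.
move=> h n; rewrite coef_sum.
apply: (@ratcoef_ext _ (fun k => \sum_(i <- r) (F i k)`_n)) => [k _|].
  by rewrite coef_sum.
by apply: ratcoef_sum => i _; apply: h.
Qed.

Lemma ratpoly_monomial m c s : ratcoef m c s ->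
  ratpoly (fun k => (c k)%:P * 'X^m) (s%:P * 'X^m).
Proof.
move=> h n; rewrite coefCM coefXn; have [->|nm] := eqVneq n m.
  by rewrite mulr1; apply: ratcoef_ext h => k _; rewrite coefCM coefXn eqxx mulr1.
rewrite mulr0; apply: ratcoef_ext (ratcoef0 _) => k _.
by rewrite coefCM coefXn (negPf nm) mulr0.
Qed.

Lemma ratpoly_altsum (a : nat -> nat -> R) (alpha : nat -> K) F G N :
  (forall l, ratcoef (triang l) (a^~ l) (alpha l)) -> ratpoly F G ->
  ratpoly (fun k => altsum (fun l => (a k l)%:P) 'X (F k) N)
    (altsum (fun l => (alpha l)%:P) 'X G N).
Proof.
move=> h hF; rewrite /altsum; apply: ratpoly_sum => l.
have hs : ratpoly (fun=> (-1) ^+ l) ((-1) ^+ l).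
  by apply: ratpolyX; apply: ratpolyN; exact: ratpoly1.
rewrite -[(-1) ^+ l * _ * _]mulrA => n.
apply: ratcoef_ext (ratpolyM (ratpolyM hs (ratpoly_monomial (h l))) (ratpolyX l hF) n) => k _.
by rewrite !mulrA.
Qed.

(** The recursion uses ring operations only, so the coefficients over [R] and their expansions in
    [K] advance in parallel. Both orders of the pair occur, hence the induction for all [a] and
    [b]. *)
Lemma ratpoly_sol N (a b : nat -> nat -> R) (alpha beta : nat -> K) :
  (forall l, ratcoef (triang l) (a^~ l) (alpha l)) ->
  (forall l, ratcoef (triang l) (b^~ l) (beta l)) ->
  ratpoly (fun k => sol N (a k) (b k)) (sol N alpha beta).
Proof.
elim: N a b alpha beta => [|N IH] a b alpha beta ha hb /=; first exact: ratpoly1.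
rewrite /wstep; apply: ratpolyD.
  apply: ratpolyD; first exact: ratpoly1.
  by apply: ratpoly_altsum => //; apply: IH.
apply: ratpolyN; apply: ratpolyM; first exact: IH.
by apply: ratpoly_altsum => //; apply: IH.
Qed.

Definition invfac (F : fieldType) (s : F) (l : nat) : F :=
  \prod_(1 <= i < l.+1) (1 + i%:R * s)^-1.

Lemma evinv_linear k i : evinv k (1 + i%:R * 'X) = 1 + i%:R * k%:R^-1.
Proof.
rewrite evinvD evinvM /evinv rmorph1 hornerC map_polyX hornerX rmorph_nat.
by rewrite -polyC_natr hornerC.
Qed.

Lemma evinv_prod k (r : seq nat) (F : nat -> {poly int}) :
  evinv k (\prod_(i <- r) F i) = \prod_(i <- r) evinv k (F i).
Proof.
elim: r => [|i r IH]; last by rewrite !big_cons evinvM IH.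
by rewrite !big_nil /evinv rmorph1 hornerC.
Qed.

(** A polynomial in [1/k] of degree at most [l <= triang l], which the factor [x^(triang l)] of
    [Qpoly (triang l)] absorbs. *)
Lemma ratcoef_lowfac l :
  ratcoef (triang l) (fun k => lowfac k%:R^-1 l) (lowfac (phi 'X) l).
Proof.
exists (Qrev (triang l) * \prod_(1 <= i < l.+1) (1 - i%:R * 'X)); split.
- rewrite (leq_trans (size_polyMleq _ _)) //.
  have h : (size (\prod_(1 <= i < l.+1) (1 - i%:R * 'X) : {poly int})%R <= l.+1)%N.
    elim: l => [|l IH]; first by rewrite big_geq // size_poly1.
    rewrite big_nat_recr //= (leq_trans (size_polyMleq _ _)) //.
    rewrite mulr_natl -scaler_nat -scaleNr.
    by rewrite -subn1 leq_subLR add1n (leq_trans (leq_add IH (size_linear_factor _))) // addn2.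
  have h' := size_linprod (triang l) (gam (triang l)).
  rewrite -/(Qrev _) -(mu0E (leqnn _)) in h'.
  rewrite -subn1 leq_subLR add1n (leq_trans (leq_add h' h)) //.
  by have := leq_triang l; lia.
- move=> k k0; rewrite evinvM mulrC; congr (_ * _); rewrite evinv_prod; apply: eq_bigr => i _.
  rewrite /evinv rmorphB hornerD rmorph1 hornerC rmorphM hornerN hornerM /=.
  by rewrite map_polyX hornerX rmorph_nat -polyC_natr hornerC.
- rewrite rmorphM; congr (_ * _); rewrite rmorph_prod; apply: eq_bigr => i _.
  by rewrite rmorphB rmorph1 rmorphM rmorph_nat.
Qed.

(** For [i <= l] the factor [1 + i/k] occurs in [Qrev (triang l)], because
    [i (i + 1) <= l (l + 1) = 2 triang l] makes its exponent positive. *)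
Lemma ratcoef_invfac l :
  ratcoef (triang l) (fun k => invfac k%:R^-1 l) (invfac_trunc (phi 'X) l).
Proof.
pose I : {poly int} := \prod_(1 <= i < l.+1) (1 + i%:R * 'X).
have IE : I = linprod (triang l) (fun i => (i <= l)%N).
  rewrite (linprod_widen (leq_triang l)); last by move=> i; rewrite ltnNge => /negPf ->.
  by rewrite /I /linprod !big_nat; apply: eq_bigr => i /andP[_]; rewrite ltnS => ->; rewrite expr1.
pose P := linprod (triang l) (fun i => gam (triang l) i - (i <= l))%N.
have QE : Qrev (triang l) = P * I.
  rewrite IE linprodM; apply: eq_linprod => i /andP[i0 _]; rewrite subnK //.
  by case: (leqP i l) => //= il; apply: gam_triang; rewrite i0.
exists P; split.
- rewrite (leq_trans (size_linprod _ _)) // ltnS (mu0E (leqnn _)).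
  by rewrite (leq_trans _ (leq_addl _ _)) //; apply: leq_sum => i _; rewrite leq_subr.
- move=> k k0; rewrite QE evinvM mulrCA -[RHS]mulr1; congr (_ * _).
  rewrite /I evinv_prod /invfac -big_split /= big1 // => i _.
  have pos : 0 < 1 + i%:R * k%:R^-1 :> R by rewrite ltr_pwDl // mulr_ge0 // invr_ge0.
  by rewrite evinv_linear mulVf // gt_eqF.
- rewrite QE rmorphM -mulrA -[LHS]mulr1; congr (_ * _).
  rewrite /I rmorph_prod /invfac_trunc -big_split /= big1 // => i _.
  rewrite rmorphD rmorph1 rmorphM rmorph_nat.
  transitivity (1 - i%:R ^+ 4 * phi 'X ^+ 4); first by ring.
  by rewrite phiX4 mulr0 subr0.
Qed.

End RationalCoefficients.

(** * Reversal between [1/k] and [k], and the leading coefficients *)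

Lemma monic_prod_size (e : nat -> nat) L :
  let p : {poly int} := \prod_(1 <= l < L.+1) ('X + (l%:Z)%:P) ^+ e l in
  p \is monic /\ size p = (\sum_(1 <= l < L.+1) e l).+1.
Proof.
elim: L => [|L [mL sL]] /=; first by rewrite !big_geq // size_poly1 monic1.
rewrite big_nat_recr //= [X in _ = X.+1]big_nat_recr //=.
have eX : 'X + (L.+1%:Z)%:P = 'X - (- L.+1%:Z)%:P :> {poly int}.
  by rewrite polyCN opprK.
have mX : ('X + (L.+1%:Z)%:P : {poly int}) ^+ e L.+1 \is monic.
  by rewrite eX monic_exp // monicXsubC.
split; first by rewrite monicMr.
rewrite size_Mmonic ?monic_neq0 // sL eX size_exp_XsubC.
by rewrite addSn addnS.
Qed.

Lemma MdegE n : Mdeg n = (n + mu 0 n)%N.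
Proof.
have [mP sP] := monic_prod_size (gam n) n.
rewrite /Mdeg /Qpoly size_Mmonic //; last by rewrite -size_poly_gt0 size_polyXn.
by rewrite size_polyXn sP addSn addnS /= (mu0E (leqnn _)).
Qed.

Lemma gam1 n : gam n 1 = n.
Proof. by rewrite /gam mul1n mulKn. Qed.

Section Reversal.
Variable R : numFieldType.
Implicit Types (k n : nat) (P : {poly int}).

(** The reversal is at a prescribed degree [M], not at the degree of [P]: vanishing low coefficients
    of [P] then show up as a drop in degree. *)
Definition revpoly M P : {poly int} := \poly_(i < M.+1) P`_(M - i).

Lemma revpoly_horner M P k : (size P <= M.+1)%N -> (0 < k)%N ->
  ((revpoly M P).[k%:Z])%:~R = k%:R ^+ M * evinv R k P.
Proof.
move=> sP k0; have k0R : k%:R != 0 :> R by rewrite pnatr_eq0 -lt0n.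
rewrite horner_poly rmorph_sum /evinv (horner_coef_wide _ (n := M.+1)); last first.
  by rewrite (leq_trans (size_poly _ _)).
rewrite mulr_sumr (reindex_inj rev_ord_inj) /=; apply: eq_bigr => i _.
have iM : (i <= M)%N by rewrite -ltnS.
rewrite subSS rmorphM rmorphXn /= subKn // coef_map /= mulrCA; congr (_ * _).
rewrite -pmulrn; move: (i : nat) iM => j jM.
by rewrite -{2}(subnK jM) exprD -mulrA -exprMn divff // expr1n mulr1.
Qed.

Lemma Qpoly_horner n k : (0 < k)%N ->
  ((Qpoly n).[k%:Z])%:~R = k%:R ^+ Mdeg n * evinv R k (Qrev n).
Proof.
move=> k0; have k0R : k%:R != 0 :> R by rewrite pnatr_eq0 -lt0n.
rewrite MdegE exprD (mu0E (leqnn _)) /Qpoly hornerM hornerXn rmorphM rmorphXn /= -mulrA.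
congr (_ * _); rewrite horner_prod rmorph_prod /= /Qrev /linprod evinv_prod.
rewrite expr_sum -big_split /=; apply: eq_bigr => l _.
rewrite horner_exp rmorphXn /=; have -> : evinv R k ((1 + l%:R * 'X) ^+ gam n l) =
    evinv R k (1 + l%:R * 'X) ^+ gam n l by rewrite /evinv rmorphXn horner_exp.
rewrite -exprMn evinv_linear mulrDr mulr1 mulrCA divff // mulr1; congr (_ ^+ _).
by rewrite hornerD hornerX hornerC rmorphD.
Qed.

Lemma evinv_Qrev_neq0 n k : (0 < k)%N -> evinv R k (Qrev n) != 0.
Proof.
move=> k0; rewrite /Qrev /linprod evinv_prod prodf_seq_neq0; apply/allP => l _ /=.
rewrite /evinv rmorphXn horner_exp -/(evinv R k _) expf_neq0 // evinv_linear.
have pos : 0 < 1 + l%:R * k%:R^-1 :> R by rewrite ltr_pwDl // mulr_ge0 // invr_ge0.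
by rewrite gt_eqF.
Qed.

End Reversal.

Local Notation Zt4 := {poly %/ ('X^4 : {poly int})}.

Definition modt4 : {rmorphism {poly int} -> Zt4} := in_qpoly 'X^4.

Lemma modt4_X4 : modt4 'X ^+ 4 = 0.
Proof.
rewrite -rmorphXn; apply: val_inj => /=.
by rewrite mk_monic_Xn Pdiv.RingMonic.rmodpp // monicXn.
Qed.

Lemma modt4_eqmX p q : modt4 p = modt4 q -> eqmX 4 p q.
Proof.
move=> /(congr1 val) /=; rewrite mk_monic_Xn /= => e.
have m4 : ('X^4 : {poly int}) \is monic by apply: monicXn.
move=> i li; rewrite (Pdiv.RingMonic.rdivp_eq m4 p) (Pdiv.RingMonic.rdivp_eq m4 q).
by rewrite !coefD !coefMXn li e.
Qed.

(** Modulo [X^4] the numerator is [(1 + mu_1(n) X) sigma(n) (X^2 - n X^3)]; its coefficients 0 to 3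
    become those of degrees [M_n] down to [M_n - 3]. *)
Lemma ratcoef_form (R : realType) n (c : nat -> R) (s : Zt4) : (0 < n)%N ->
  s = (sigma n)%:R * (modt4 'X ^+ 2 - n%:R * modt4 'X ^+ 3) ->
  ratcoef modt4 n c s -> exists P : {poly int},
    (forall k, (0 < k)%N -> c k = coef_ratio P n k) /\ ((2 <= n)%N -> has_form P n).
Proof.
move=> n0 -> [P [sP cP phiP]]; exists (revpoly (Mdeg n) P); split.
  move=> k k0; have k0R : k%:R != 0 :> R by rewrite pnatr_eq0 -lt0n.
  rewrite /coef_ratio (revpoly_horner _ _ k0) ?MdegE //.
  rewrite -MdegE Qpoly_horner // -cP // mulrCA mulfK // mulf_neq0 ?expf_neq0 //.
  exact: evinv_Qrev_neq0.
move=> n2.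
have hP : eqmX 4 P (Qrev n * ((sigma n)%:R * ('X^2 - n%:R * 'X^3))).
  apply: modt4_eqmX; rewrite phiP rmorphM; congr (_ * _).
  by rewrite rmorphM rmorphB rmorphXn rmorphM rmorphXn !rmorph_nat.
(* The exponent of the factor [l = 1] alone is [n], so [M_n >= 2n >= 4] and no subtraction in
   [has_form] is truncated. *)
have M4 : (4 <= Mdeg n)%N.
  by rewrite MdegE /mu big_ltn // expn0 mul1n gam1; lia.
have c0 := linprod_coef0 n (gam n); have c1 := linprod_coef1 n (gam n).
rewrite -/(Qrev n) in c0 c1.
have e1 : (\sum_(1 <= l < n.+1) l * gam n l)%N = mu 1 n.
  by apply: eq_bigr => l _; rewrite expn1.
have hc i : (i < 4)%N -> P`_i = (sigma n)%:R *
    ((if (i < 2)%N then 0 else (Qrev n)`_(i - 2)) -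
      n%:R * (if (i < 3)%N then 0 else (Qrev n)`_(i - 3))).
  move=> li; rewrite hP //.
  have -> : Qrev n * ((sigma n)%:R * ('X^2 - n%:R * 'X^3)) =
    (sigma n)%:R * (Qrev n * 'X^2 - n%:R * (Qrev n * 'X^3)) by ring.
  by rewrite mulr_natl coefMn coefB mulr_natl coefMn !coefMXn [RHS]mulr_natl mulr_natl.
rewrite /has_form /revpoly; split; [|split].
- move=> i li; rewrite coef_poly; case: ltnP => // iM.
  have /orP[/eqP ->|/eqP ->] : ((Mdeg n - i == 0) || (Mdeg n - i == 1))%N by lia.
    by rewrite hc //= mulr0 subr0 mulr0.
  by rewrite hc //= mulr0 subr0 mulr0.
- rewrite coef_poly ifT; last by lia.
  have -> : (Mdeg n - (Mdeg n - 2) = 2)%N by lia.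
  by rewrite hc //= c0 mulr0 subr0 mulr1 natz.
- rewrite coef_poly ifT; last by lia.
  have -> : (Mdeg n - (Mdeg n - 3) = 3)%N by lia.
  by rewrite hc //= c0 c1 e1 mulr1 !natz.
Qed.

Lemma sol_rational (R : realType) : exists P Ph : nat -> {poly int},
  (forall n k, (0 < n)%N -> (0 < k)%N ->
    (sol n (invfac (k%:R^-1 : R)) (lowfac k%:R^-1))`_n = coef_ratio (P n) n k /\
    (sol n (lowfac (k%:R^-1 : R)) (invfac k%:R^-1))`_n = - coef_ratio (Ph n) n k) /\
  (forall n, (2 <= n)%N -> has_form (P n) n /\ has_form (Ph n) n).
Proof.
have t4 := modt4_X4.
have hA := @ratcoef_invfac R _ _ t4; have hB := @ratcoef_lowfac R _ modt4.
have h n : exists PP : {poly int} * {poly int}, (0 < n)%N ->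
   ((forall k, (0 < k)%N ->
    (sol n (invfac (k%:R^-1 : R)) (lowfac k%:R^-1))`_n = coef_ratio PP.1 n k /\
    (sol n (lowfac (k%:R^-1 : R)) (invfac k%:R^-1))`_n = - coef_ratio PP.2 n k) /\
  ((2 <= n)%N -> has_form PP.1 n /\ has_form PP.2 n)).
  case: (posnP n) => [->|n0]; first by exists (0, 0).
  have [s1 s2] := @sol_nilpotent _ _ t4 n n (leqnn n).
  have cc := @correction_coef _ (modt4 'X) n n; rewrite n0 leqnn in cc.
  have h1 := @ratpoly_sol R _ modt4 n _ _ _ _ hA hB n.
  have h2 := @ratpoly_sol R _ modt4 n _ _ _ _ hB hA n.
  rewrite s1 // coefD coef1 gtn_eqF // add0r cc // in h1.
  rewrite s2 // coefB coef1 gtn_eqF // sub0r cc // in h2.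
  have [P [P1 P2]] := ratcoef_form n0 erefl h1.
  have := ratcoefN h2; rewrite opprK => /(ratcoef_form n0 erefl)[Ph [Ph1 Ph2]].
  exists (P, Ph) => _; split=> [k k0|n2] /=; last by split; [apply: P2|apply: Ph2].
  by rewrite -P1 // -Ph1 // opprK.
have [PP hPP] := choice h.
exists (fun n => (PP n).1), (fun n => (PP n).2); split=> [n k n0 k0|n n2].
  by have [+ _] := hPP n n0; apply.
by have [|_] := hPP n; [exact: ltnW|apply].
Qed.

(** * The degree of Q_n *)

Local Open Scope classical_set_scope.

(** The sum of [2n / (l (l + 1))] telescopes to [2n L / (L + 1)], and floors only lower it. *)
Lemma sum_gam_ub n L : ((\sum_(1 <= l < L.+1) gam n l) * L.+1 <= 2 * n * L)%N.
Proof.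
elim: L => [|L IH]; first by rewrite big_geq.
rewrite big_nat_recr //=; set S := (\sum_(_ <= _ < _) _)%N in IH *.
have hg : (gam n L.+1 * (L.+1 * L.+2) <= 2 * n)%N by rewrite /gam leq_divM.
rewrite -(leq_pmul2r (ltn0Sn L)); move: (gam n L.+1) hg => g hg; nia.
Qed.

(** The same telescoping sum, each floor losing at most one. *)
Lemma sum_gam_lb n L : (2 * n * L <= (\sum_(1 <= l < L.+1) gam n l + L) * L.+1)%N.
Proof.
elim: L => [|L IH]; first by rewrite muln0.
rewrite big_nat_recr //=; set S := (\sum_(_ <= _ < _) _)%N in IH *.
have hg : (2 * n <= (gam n L.+1).+1 * (L.+1 * L.+2))%N.
  by rewrite ltnW // /gam ltn_ceil.
rewrite -(leq_pmul2r (ltn0Sn L)); move: (gam n L.+1) hg => g hg; nia.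
Qed.

Lemma Mdeg_lt n : (0 < n)%N -> (Mdeg n < 3 * n)%N.
Proof. by move=> n0; rewrite MdegE (mu0E (leqnn _)); have := sum_gam_ub n n; nia. Qed.

Lemma Mdeg_ge n L : (L <= n)%N -> (3 * n * L <= (Mdeg n + L) * L.+1)%N.
Proof.
move=> leLn; rewrite MdegE (mu0E (leqnn _)) (big_cat_nat _ (n := L.+1)) //=.
by have := sum_gam_lb n L; nia.
Qed.

Lemma Mdeg_ratio_cvg (R : realType) :
  (fun n : nat => (Mdeg n)%:R / n%:R : R) @ \oo --> (3 : R).
Proof.
apply/cvgrPdist_le => e e0.
(* The bounds give [3 - M_n/n <= 3/(L + 1) + L/n]; this [L] together with [n >= 2L/e] makes each
   part at most [e/2]. *)
have [L hL] : exists L : nat, 6 / e < L%:R.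
  by exists (Num.bound (6 / e)); apply: archi_boundP; rewrite divr_ge0 // ltW.
near=> n.
have n0 : (0 < n)%N by near: n; exact: nbhs_infty_gt.
have nL : (L <= n)%N by near: n; exact: nbhs_infty_ge.
have hn : 2 * L%:R / e <= n%:R by near: n; exact: nbhs_infty_ger.
have n0R : 0 < n%:R :> R by rewrite ltr0n.
have ub : (Mdeg n)%:R <= 3 * n%:R :> R.
  by rewrite -natrM ler_nat ltnW // Mdeg_lt.
have lb : 3 * n%:R * L%:R <= ((Mdeg n)%:R + L%:R) * (L%:R + 1) :> R.
  by rewrite -natrD natr1 -!natrM ler_nat Mdeg_ge.
have -> : 3 - (Mdeg n)%:R / n%:R = (3 * n%:R - (Mdeg n)%:R) / n%:R :> R.
  by rewrite mulrBl mulfK // gt_eqF.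
rewrite ger0_norm; last by apply: divr_ge0; [rewrite subr_ge0|exact: ltW].
rewrite ler_pdivrMr //.
move: hL hn; rewrite ltr_pdivrMr // ler_pdivrMr //.
have L0 : 0 <= L%:R :> R by [].
move: lb ub; move: (Mdeg n)%:R n%:R (L%:R) n0R L0 => m x l x0 l0 lb ub hL hn.
have h : (3 * x - m) * (l + 1) <= 3 * x + l * (l + 1) by nra.
rewrite -(ler_pM2r (_ : 0 < l + 1)); last by lra.
apply: le_trans h _; nra.
Unshelve. all: by end_near.
Qed.

Lemma sigma_gt0 n : (0 < n)%N -> (0 < sigma n)%N.
Proof.
move=> n0; rewrite /sigma (bigD1_seq n) ?divisors_uniq //=; last by rewrite divisors_id.
by rewrite addn_gt0 n0.
Qed.

(** The term [l = 1] contributes exactly [n], and [l = 2] enters as soon as [2n >= 6]. *)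
Lemma mu1_gt n : (3 <= n)%N -> (n < mu 1 n)%N.
Proof.
move=> n3; rewrite /mu big_ltn; last by lia.
rewrite big_ltn; last by lia.
rewrite !expn1 mul1n gam1.
have : (0 < gam n 2)%N by rewrite /gam divn_gt0 //; lia.
by lia.
Qed.

Lemma mu1_2 : mu 1 2 = 2%N.
Proof. by rewrite /mu big_ltn // big_ltn // big_geq. Qed.

(** * Convergence *)

Section PolynomialNorm.
Variables (R : realFieldType) (r : R).
Hypothesis r0 : 0 <= r.
Implicit Types p q : {poly R}.

(** The weighted l^1 norm of radius [r]: submultiplicative, hence compatible with the recursion of
    [sol], and controlling values and tails at all points of [[0, r]]. *)
Definition pnorm p : R := \sum_(i < size p) `|p`_i| * r ^+ i.

Lemma pnorm_wide n p : (size p <= n)%N -> pnorm p = \sum_(i < n) `|p`_i| * r ^+ i.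
Proof.
move=> le; rewrite /pnorm (big_ord_widen n (fun i => `|p`_i| * r ^+ i)) // big_mkcond /=.
by apply: eq_bigr => i _; case: ltnP => // h; rewrite nth_default // normr0 mul0r.
Qed.

Lemma pnorm_ge0 p : 0 <= pnorm p.
Proof. by apply: sumr_ge0 => i _; rewrite mulr_ge0 // exprn_ge0. Qed.

Lemma pnorm_coef p i : `|p`_i| * r ^+ i <= pnorm p.
Proof.
rewrite (@pnorm_wide (maxn i.+1 (size p))) ?leq_maxr //.
have h : (i < maxn i.+1 (size p))%N by rewrite leq_maxl.
rewrite (bigD1 (Ordinal h)) //= lerDl.
by apply: sumr_ge0 => j _; rewrite mulr_ge0 // exprn_ge0.
Qed.

Lemma pnorm0 : pnorm 0 = 0.
Proof. by rewrite /pnorm size_poly0 big_ord0. Qed.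

Lemma pnormC c : pnorm c%:P = `|c|.
Proof.
rewrite (@pnorm_wide 1) ?size_polyC ?leq_b1 // big_ord_recl big_ord0 coefC /=.
by rewrite addr0 mulr1.
Qed.

Lemma pnormN p : pnorm (- p) = pnorm p.
Proof. by rewrite /pnorm size_polyN; apply: eq_bigr => i _; rewrite coefN normrN. Qed.

Lemma pnormD p q : pnorm (p + q) <= pnorm p + pnorm q.
Proof.
set n := maxn (size p) (size q).
rewrite !(@pnorm_wide n) ?leq_maxl ?leq_maxr ?size_polyD // -big_split /=.
apply: ler_sum => i _; rewrite coefD -mulrDl ler_wpM2r ?exprn_ge0 //.
exact: ler_normD.
Qed.

Lemma pnorm_sum (I : Type) (s : seq I) (F : I -> {poly R}) :
  pnorm (\sum_(i <- s) F i) <= \sum_(i <- s) pnorm (F i).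
Proof.
elim: s => [|i s IH]; first by rewrite !big_nil pnorm0.
by rewrite !big_cons (le_trans (pnormD _ _)) // lerD2l.
Qed.

Lemma pnormZXn c m p : pnorm (c *: ('X^m * p)) = `|c| * r ^+ m * pnorm p.
Proof.
rewrite (@pnorm_wide (m + size p)); last first.
  rewrite (leq_trans (size_scale_leq _ _)) // (leq_trans (size_polyMleq _ _)) //.
  by rewrite size_polyXn addSn.
rewrite big_split_ord /= big1 ?add0r => [|i _]; last first.
  by rewrite coefZ coefXnM ltn_ord mulr0 normr0 mul0r.
rewrite /pnorm mulr_sumr; apply: eq_bigr => i _.
rewrite coefZ coefXnM ltnNge leq_addr /= addKn normrM exprD; ring.
Qed.

Lemma pnormM p q : pnorm (p * q) <= pnorm p * pnorm q.
Proof.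
have -> : p * q = \sum_(i < size p) p`_i *: ('X^i * q).
  rewrite -{1}[p]coefK poly_def mulr_suml; apply: eq_bigr => i _.
  by rewrite scalerAl.
rewrite (le_trans (pnorm_sum _ _)) // [X in _ <= X * _]/pnorm mulr_suml.
by apply: ler_sum => i _; rewrite pnormZXn.
Qed.

Lemma pnormX p n : pnorm (p ^+ n) <= pnorm p ^+ n.
Proof.
elim: n => [|n IH]; first by rewrite !expr0 -polyC1 pnormC normr1.
by rewrite !exprS (le_trans (pnormM _ _)) // ler_wpM2l // pnorm_ge0.
Qed.

Lemma horner_pnorm p x : 0 <= x <= r -> `|p.[x]| <= pnorm p.
Proof.
move=> /andP[x0 xr]; rewrite horner_coef (le_trans (ler_norm_sum _ _ _)) //.
apply: ler_sum => i _; rewrite normrM ler_wpM2l // normrX ger0_norm //.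
by rewrite lerXn2r ?nnegrE.
Qed.

Lemma horner_tail p x n : 0 <= x <= r -> 0 < r ->
  `|p.[x] - \sum_(0 <= i < n) p`_i * x ^+ i| <= (x / r) ^+ n * pnorm p.
Proof.
move=> /andP[x0 xr] rp; set m := maxn n (size p).
have nm : (n <= m)%N by rewrite leq_maxl.
rewrite (horner_coef_wide _ (leq_maxr n (size p))) -/m.
rewrite -(big_mkord xpredT (fun i => p`_i * x ^+ i)) (big_cat_nat _ (n := n)) //=.
rewrite addrAC subrr add0r (@pnorm_wide m) ?leq_maxr //.
rewrite -(big_mkord xpredT (fun i => `|p`_i| * r ^+ i)).
rewrite [X in _ <= _ * X](big_cat_nat _ (n := n)) //=.
rewrite (le_trans (ler_norm_sum _ _ _)) // mulrDr.
apply: le_trans (_ : _ <= (x / r) ^+ n * \sum_(n <= i < m) `|p`_i| * r ^+ i) _; last first.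
  rewrite lerDr mulr_ge0 ?exprn_ge0 ?divr_ge0 // big_nat.
  by apply: sumr_ge0 => i _; rewrite mulr_ge0 // exprn_ge0.
rewrite mulr_sumr !big_nat; apply: ler_sum => i /andP[ni _].
rewrite normrM normrX (ger0_norm x0) mulrCA ler_wpM2l //.
have -> : x ^+ i = (x / r) ^+ i * r ^+ i by rewrite -exprMn divfK // gt_eqF.
rewrite ler_wpM2r ?exprn_ge0 // -(subnKC ni) exprD ler_piMr ?exprn_ge0 ?divr_ge0 //.
by rewrite exprn_ile1 ?divr_ge0 // ler_pdivrMr // mul1r.
Qed.

End PolynomialNorm.

Lemma cvg0_le (R : realType) (u v : nat -> R) :
  (forall n, `|u n| <= v n) -> v @ \oo --> (0 : R) -> u @ \oo --> (0 : R).
Proof.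
move=> h hv; apply: (@squeeze_cvgr _ _ _ _ (fun n => - v n) v) => //.
  by near=> n; rewrite -ler_norml.
by rewrite -oppr0; apply: cvgN.
Unshelve. all: by end_near.
Qed.

Lemma cvg0D (R : realType) (u v : nat -> R) : u @ \oo --> (0 : R) -> v @ \oo --> (0 : R) ->
  (fun n => u n + v n) @ \oo --> (0 : R).
Proof. by move=> hu hv; have := cvgD hu hv; rewrite addr0; apply. Qed.

Lemma cvg0Z (R : realType) (c : R) (u : nat -> R) : u @ \oo --> (0 : R) ->
  (fun n => c * u n) @ \oo --> (0 : R).
Proof. by move=> hu; have := cvgM (@cvg_cst _ c _ \oo _) hu; rewrite mulr0; apply. Qed.

Lemma cvg0_norm (R : realType) (u : nat -> R) : u @ \oo --> (0 : R) ->
  (fun n => `|u n|) @ \oo --> (0 : R).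
Proof. by move=> hu; have := cvg_norm hu; rewrite normr0; apply. Qed.

Lemma cvg_sub0 (R : realType) (x : R) (u : nat -> R) : u @ \oo --> x ->
  (fun n => u n - x) @ \oo --> (0 : R).
Proof. by move=> hu; have := cvgB hu (@cvg_cst _ x _ \oo _); rewrite subrr; apply. Qed.

Lemma geometric_sum_le (R : realFieldType) (x : R) N : 0 <= x <= 2^-1 ->
  \sum_(1 <= l < N.+1) x ^+ l <= 2 * x.
Proof.
move=> /andP[x0 x2]; have h := geometric_tail x N.
have s0 : 0 <= \sum_(1 <= l < N.+1) x ^+ l by apply: sumr_ge0 => l _; rewrite exprn_ge0.
have p0 : 0 <= x ^+ N.+1 by rewrite exprn_ge0.
nra.
Qed.

(** * The limit of the iterates as a real fixed point *)

Section Estimates.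
Variable R : realType.
Implicit Types (a b : nat -> R) (q w v x y : R).

(** The strictest demand comes from [fixpoint_unique], where the Lipschitz constant [384 q] has to
    be below [1/2]. *)
Definition rho : R := 1000^-1.

Definition bounded1 a := forall l, `|a l| <= 1.

Lemma pnorm_altsum a (w : {poly R}) N : bounded1 a -> pnorm rho w <= 2 ->
  pnorm rho (altsum (fun l => (a l)%:P) 'X w N) <= 2 * (rho * pnorm rho w).
Proof.
move=> ha w2; have r0 : 0 <= rho by rewrite /rho; lra.
have n0 := pnorm_ge0 r0 w.
apply: le_trans (pnorm_sum r0 _ _) _; apply: le_trans (geometric_sum_le N _); last first.
  by rewrite /rho in r0 *; apply/andP; split; [nra|lra].
rewrite !big_nat; apply: ler_sum => l _.
have -> : (-1) ^+ l * (a l)%:P * 'X^(triang l) * w ^+ l =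
  ((-1) ^+ l * a l) *: ('X^(triang l) * w ^+ l).
  by rewrite -mul_polyC polyCM rmorph_sign !mulrA.
rewrite pnormZXn // normrMsign exprMn.
have h1 : `|a l| * rho ^+ triang l <= rho ^+ l.
  rewrite -[X in _ <= X]mul1r; apply: ler_pM => //; first exact: exprn_ge0.
  by apply: ler_wiXn2l; rewrite ?leq_triang // /rho; lra.
apply: ler_pM => //; [|exact: pnorm_ge0|exact: pnormX].
by rewrite mulr_ge0 // exprn_ge0.
Qed.

(** Inductively both unknowns have norm at most [3/2], so both alternating sums have norm at most
    [3 rho], far less than the radius [1/2] allows. *)
Lemma pnorm_sol N a b : bounded1 a -> bounded1 b -> pnorm rho (sol N a b - 1) <= 2^-1.
Proof.
have r0 : 0 <= rho by rewrite /rho; lra.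
elim: N a b => [|N IH] a b ha hb /=; first by rewrite subrr pnorm0; lra.
have h2 c d : bounded1 c -> bounded1 d -> pnorm rho (sol N c d) <= 3 / 2.
  move=> hc hd; rewrite -[sol N c d](subrK 1) (le_trans (pnormD r0 _ _)) //.
  by have := IH c d hc hd; rewrite -polyC1 pnormC // normr1; lra.
have hw := h2 _ _ ha hb; have hv := h2 _ _ hb ha.
set w := sol N a b in hw *; set v := sol N b a in hv *.
have e : wstep (fun l => (a l)%:P) (fun l => (b l)%:P) 'X w v N.+1 - 1 =
  altsum (fun l => (b l)%:P) 'X v N.+1 - w * altsum (fun l => (a l)%:P) 'X w N.+1.
  by rewrite /wstep; ring.
rewrite e (le_trans (pnormD r0 _ _)) // pnormN.
have ha' := @pnorm_altsum a w N.+1 ha; have hb' := @pnorm_altsum b v N.+1 hb.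
have hm := pnormM r0 w (altsum (fun l => (a l)%:P) 'X w N.+1).
have := pnorm_ge0 r0 w; have := pnorm_ge0 r0 v.
move: hm ha' hb'.
move: (pnorm rho (w * _)) (pnorm rho (altsum _ _ w _)) (pnorm rho (altsum _ _ v _)) => m sa sb.
move: (pnorm rho w) (pnorm rho v) hw hv => nw nv hw hv hm ha' hb' v0 w0.
have {}ha' := ha' (ltac:(lra)); have {}hb' := hb' (ltac:(lra)).
rewrite /rho in ha' hb'.
have : nw * sa <= 2 * 2 / 100 by nra.
lra.
Qed.

Lemma horner_altsum a q (w : {poly R}) N :
  (altsum (fun l => (a l)%:P) 'X w N).[q] = altsum a q w.[q] N.
Proof.
rewrite /altsum horner_sum; apply: eq_bigr => l _.
by rewrite !hornerM hornerXn hornerC !horner_exp hornerN hornerC.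
Qed.

Lemma horner_sol N a b q :
  (sol N.+1 a b).[q] = wstep a b q (sol N a b).[q] (sol N b a).[q] N.+1.
Proof. by rewrite /= /wstep hornerD hornerN hornerM hornerD hornerC !horner_altsum. Qed.

Lemma sol_cvg a b q : bounded1 a -> bounded1 b -> 0 < q < rho -> exists w : R,
  [/\ series (fun n => (sol n a b)`_n * q ^+ n) @ \oo --> w,
      (fun N => (sol N a b).[q]) @ \oo --> w & `|w - 1| <= 2^-1].
Proof.
move=> ha hb /andP[q0 qr].
have r0 : 0 < rho by rewrite /rho; lra.
have qr01 : `|q / rho| < 1.
  by rewrite ger0_norm ?divr_ge0 ?ltW // ltr_pdivrMr // mul1r.
have qqr : 0 <= q <= rho by rewrite !ltW.
have qd0 : 0 <= q / rho by rewrite divr_ge0 // ltW.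
have hn N : pnorm rho (sol N a b) <= 2.
  rewrite -[sol N a b](subrK 1) (le_trans (pnormD (ltW r0) _ _)) //.
  by have := @pnorm_sol N a b ha hb; rewrite -polyC1 pnormC // normr1; lra.
set u := fun n => (sol n a b)`_n * q ^+ n.
have cu : cvgn (series u).
  apply: normed_cvg; apply: (@series_le_cvg _ _ (geometric 2 (q / rho))).
  - by move=> n /=.
  - by move=> n /=; rewrite mulr_ge0 // exprn_ge0 // divr_ge0 // ltW.
  - move=> n /=; rewrite /u normrM normrX (ger0_norm (ltW q0)).
    have -> : q ^+ n = rho ^+ n * (q / rho) ^+ n.
      by rewrite -exprMn mulrCA divff ?mulr1 // gt_eqF.
    rewrite mulrA ler_wpM2r ?exprn_ge0 //.
    by rewrite (le_trans (pnorm_coef (ltW r0) _ _)).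
  - exact: is_cvg_geometric_series.
pose w := limn (series u); have hw : series u @ \oo --> w by [].
(* The first [N + 1] coefficients of [sol N a b] are final, so the difference is the tail of a
   single polynomial, geometrically small because [q < rho]. *)
have hd : (fun N => (sol N a b).[q] - series u N.+1) @ \oo --> (0 : R).
  apply: (@cvg0_le _ _ (geometric 2 (q / rho))); last exact: cvg_geometric.
  move=> N; rewrite /= seriesEnat /=.
  have -> : \sum_(0 <= k < N.+1) u k = \sum_(0 <= k < N.+1) (sol N a b)`_k * q ^+ k.
    rewrite !big_nat; apply: eq_bigr => k /andP[_ kN]; rewrite /u.
    by rewrite (@sol_stable _ a b k N) // -ltnS.
  rewrite (le_trans (horner_tail (ltW r0) _ _ qqr r0)) //.
  rewrite exprS mulrC mulrA ler_wpM2r ?exprn_ge0 //.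
  rewrite -[X in _ <= X]mulr1 ler_pM ?pnorm_ge0 //; first exact: ltW.
  by rewrite ger0_norm // in qr01; exact: ltW.
have hs : (fun N => (sol N a b).[q]) @ \oo --> w.
  have -> : (fun N => (sol N a b).[q]) =
      (fun N => ((sol N a b).[q] - series u N.+1) + series u N.+1).
    by apply/funext => N; rewrite subrK.
  rewrite -[w]add0r; apply: cvgD => //.
  by rewrite (cvg_shiftS (series u)).
exists w; split=> //.
have h1 N : `|(sol N a b).[q] - 1| <= 2^-1.
  have -> : (sol N a b).[q] - 1 = (sol N a b - 1).[q] by rewrite hornerD hornerN hornerC.
  by rewrite (le_trans (horner_pnorm (ltW r0) _ qqr)) // pnorm_sol.
have hc : (fun N => `|(sol N a b).[q] - 1|) @ \oo --> `|w - 1|.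
  by apply: cvg_norm; apply: cvgB => //; exact: cvg_cst.
by apply: (cvgr_to_le hc); apply: nearW.
Qed.

(** The crude constant [8^n] closes under induction: [4 * 8^n + 4 * 8^n = 8^(n+1)]. *)
Lemma expr_lipschitz x y n : `|x| <= 4 -> `|y| <= 4 -> `|x ^+ n - y ^+ n| <= 8 ^+ n * `|x - y|.
Proof.
move=> hx hy; elim: n => [|n IH]; first by rewrite subrr normr0 mulr_ge0.
have -> : x ^+ n.+1 - y ^+ n.+1 = x * (x ^+ n - y ^+ n) + y ^+ n * (x - y).
  by rewrite !exprS; ring.
rewrite (le_trans (ler_normD _ _)) // !normrM normrX.
have h1 : `|y| ^+ n <= 4 * 8 ^+ n.
  apply: (@le_trans _ _ (8 ^+ n)); first by apply: lerXn2r; rewrite ?nnegrE //; lra.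
  by rewrite ler_peMl ?exprn_ge0 //; lra.
have h2 : `|x| * `|x ^+ n - y ^+ n| <= 4 * (8 ^+ n * `|x - y|) by apply: ler_pM.
have h3 : `|y| ^+ n * `|x - y| <= 4 * 8 ^+ n * `|x - y| by apply: ler_wpM2r.
have -> : 8 ^+ n.+1 * `|x - y| = 4 * (8 ^+ n * `|x - y|) + 4 * 8 ^+ n * `|x - y|.
  by rewrite exprS; ring.
exact: lerD.
Qed.

Lemma altsum_lipschitz a q x y N : bounded1 a -> 0 <= q <= rho ->
  `|x| <= 4 -> `|y| <= 4 -> `|altsum a q x N - altsum a q y N| <= 16 * q * `|x - y|.
Proof.
move=> ha /andP[q0 qr] hx hy; rewrite /altsum -sumrB (le_trans (ler_norm_sum _ _ _)) //.
have hq : q <= 1000^-1 by [].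
have hg : \sum_(1 <= l < N.+1) (8 * q) ^+ l <= 2 * (8 * q).
  by apply: geometric_sum_le; apply/andP; split; lra.
apply: (@le_trans _ _ (\sum_(1 <= l < N.+1) (8 * q) ^+ l * `|x - y|)); last first.
  by rewrite -mulr_suml ler_wpM2r // (le_trans hg) //; lra.
rewrite !big_nat; apply: ler_sum => l _.
rewrite -mulrBr !normrM normrX normrN1 expr1n mul1r normrX (ger0_norm q0).
have h1 : q ^+ triang l <= q ^+ l by apply: ler_wiXn2l; rewrite ?leq_triang //; lra.
have h2 : `|a l| * q ^+ triang l <= q ^+ l.
  by rewrite -[X in _ <= X]mul1r; apply: ler_pM; rewrite ?exprn_ge0.
have -> : (8 * q) ^+ l * `|x - y| = q ^+ l * (8 ^+ l * `|x - y|) by rewrite exprMn; ring.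
by apply: ler_pM => //; [rewrite mulr_ge0 // exprn_ge0|exact: expr_lipschitz].
Qed.

Lemma altsum0 a q N : altsum a q 0 N = 0.
Proof.
rewrite /altsum big_nat big1 // => l /andP[l0 _].
by rewrite expr0n gtn_eqF // mulr0.
Qed.

Lemma altsum_le a q x N : bounded1 a -> 0 <= q <= rho -> `|x| <= 4 ->
  `|altsum a q x N| <= 64 * q.
Proof.
move=> ha hq hx; have := @altsum_lipschitz a q x 0 N ha hq hx.
rewrite normr0 altsum0 !subr0 => /(_ (ltac:(lra))) /le_trans; apply.
have /andP[q0 _] := hq; have := normr_ge0 x; nra.
Qed.

Lemma wstep_lipschitz a b q w w' v v' N : bounded1 a -> bounded1 b -> 0 <= q <= rho ->
  `|w| <= 4 -> `|w'| <= 4 -> `|v| <= 4 -> `|v'| <= 4 ->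
  `|wstep a b q w v N - wstep a b q w' v' N| <= 16 * q * `|v - v'| + 128 * q * `|w - w'|.
Proof.
move=> ha hb hq hw hw' hv hv'; have /andP[q0 _] := hq.
have h1 := @altsum_lipschitz b q v v' N hb hq hv hv'.
have h2 := @altsum_lipschitz a q w w' N ha hq hw hw'.
have h3 := @altsum_le a q w N ha hq hw.
have -> : wstep a b q w v N - wstep a b q w' v' N =
  (altsum b q v N - altsum b q v' N) - ((w - w') * altsum a q w N +
    w' * (altsum a q w N - altsum a q w' N)) by rewrite /wstep; ring.
rewrite (le_trans (ler_normB _ _)) // lerD // (le_trans (ler_normD _ _)) // !normrM.
have e1 : `|w - w'| * `|altsum a q w N| <= `|w - w'| * (64 * q) by apply: ler_wpM2l.
have e2 : `|w'| * `|altsum a q w N - altsum a q w' N| <= 4 * (16 * q * `|w - w'|).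
  by apply: ler_pM.
apply: le_trans (lerD e1 e2) _; lra.
Qed.

Lemma near1_le4 w : `|w - 1| <= 2^-1 -> `|w| <= 4.
Proof. by rewrite ler_norml => /andP[h1 h2]; rewrite ler_norml; apply/andP; split; lra. Qed.

(** The infinite sums are never formed: solving the equation means that the residual of the
    truncated step tends to 0 with growing cut-off. *)
Lemma sol_fixpoint a b q : bounded1 a -> bounded1 b -> 0 < q < rho -> exists w v : R,
  [/\ series (fun n => (sol n a b)`_n * q ^+ n) @ \oo --> w,
      series (fun n => (sol n b a)`_n * q ^+ n) @ \oo --> v,
      `|w - 1| <= 2^-1, w * v = 1 &
      (fun N => wstep a b q w v N - w) @ \oo --> (0 : R)].
Proof.
move=> ha hb hq.
have [w [sw cw w1]] := sol_cvg ha hb hq; have [v [sv cv v1]] := sol_cvg hb ha hq.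
have /andP[q0 qr] := hq; have qq : 0 <= q <= rho by rewrite !ltW.
have fix1 c d (x y : R) : bounded1 c -> bounded1 d -> `|x - 1| <= 2^-1 -> `|y - 1| <= 2^-1 ->
    (fun N => (sol N c d).[q]) @ \oo --> x -> (fun N => (sol N d c).[q]) @ \oo --> y ->
    (fun N => wstep c d q x y N - x) @ \oo --> (0 : R).
  move=> hc hd x1 y1 cx cy.
  have s4 e f N : bounded1 e -> bounded1 f -> `|(sol N e f).[q]| <= 4.
    move=> he hf; apply: near1_le4.
    have -> : (sol N e f).[q] - 1 = (sol N e f - 1).[q] by rewrite hornerD hornerN hornerC.
    have r0 : 0 <= rho by rewrite /rho; lra.
    by rewrite (le_trans (horner_pnorm r0 _ qq)) // pnorm_sol.
  rewrite -cvg_shiftS /=.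
  have -> : (fun N => wstep c d q x y N.+1 - x) =
     (fun N => (wstep c d q x y N.+1 - (sol N.+1 c d).[q]) + ((sol N.+1 c d).[q] - x)).
    by apply/funext => N; rewrite addrA subrK.
  apply: cvg0D; last by apply: (@cvg_sub0 _ _ (fun N => (sol N.+1 c d).[q]));
    rewrite (cvg_shiftS (fun N => (sol N c d).[q])).
  apply: (@cvg0_le _ _ (fun N => `|y - (sol N d c).[q]| + `|x - (sol N c d).[q]|)).
    move=> N; rewrite horner_sol.
    have := @wstep_lipschitz c d q x (sol N c d).[q] y (sol N d c).[q] N.+1 hc hd qq
       (near1_le4 x1) (s4 _ _ _ hc hd) (near1_le4 y1) (s4 _ _ _ hd hc).
    move=> /le_trans; apply; rewrite /rho in qr.
    have := normr_ge0 (x - (sol N c d).[q]); have := normr_ge0 (y - (sol N d c).[q]); nra.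
  have n0 (z : R) (f : nat -> R) : f @ \oo --> z -> (fun N => `|z - f N|) @ \oo --> (0 : R).
    move=> hf; have -> : (fun N => `|z - f N|) = (fun N => `|f N - z|).
      by apply/funext => N; rewrite distrC.
    by apply: cvg0_norm; apply: cvg_sub0.
  by apply: cvg0D; apply: n0.
have f1 := fix1 _ _ _ _ ha hb w1 v1 cw cv; have f2 := fix1 _ _ _ _ hb ha v1 w1 cv cw.
exists w, v; split=> //; apply/eqP; rewrite eq_sym -subr_eq0 -normr_le0.
have hl : (fun N => 2 * `|(wstep a b q w v N - w) + w * (wstep b a q v w N - v)|) @ \oo --> (0 : R).
  by apply: cvg0Z; apply: cvg0_norm; apply: cvg0D => //; apply: cvg0Z.
apply: (cvgr_to_ge hl); apply: nearW => N.
(* The first residual plus [w] times the second is a multiple of [1 - w * v] whose other factor is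
   at least [1/2]; as residuals tend to 0, [w * v = 1]. *)
have -> : wstep a b q w v N - w + w * (wstep b a q v w N - v) =
  (1 + altsum b q v N) * (1 - w * v) by rewrite /wstep; ring.
have hb4 := @altsum_le b q v N hb qq (near1_le4 v1).
rewrite normrM.
have : 2^-1 <= `|1 + altsum b q v N|.
  move: hb4; rewrite ler_norml => /andP[h1 h2].
  by apply: le_trans (ler_norm _); rewrite /rho in qr; lra.
by have := normr_ge0 (1 - w * v); nra.
Qed.

End Estimates.

(** * Zeros of f *)

Section FactorBounds.
Variables (R : realType) (k : nat).
Hypothesis k0 : (0 < k)%N.

Lemma bounded1_invfac : bounded1 (invfac (k%:R^-1 : R)).
Proof.
elim=> [|l IH]; first by rewrite /invfac big_geq // normr1.
rewrite /invfac big_nat_recr //= normrM -[X in _ <= X]mulr1 ler_pM // normfV.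
have h : 1 <= 1 + l.+1%:R * k%:R^-1 :> R by rewrite lerDl mulr_ge0 // invr_ge0.
by rewrite ger0_norm ?invf_le1 //; apply: lt_le_trans h.
Qed.

(** The factor [i = k] vanishes. Thus the finitely many terms of [f] below the pivot fit a sum with
    any larger cut-off. *)
Lemma lowfac_eq0 l : (k <= l)%N -> lowfac (k%:R^-1 : R) l = 0.
Proof.
move=> kl; rewrite /lowfac (big_cat_nat _ (n := k.+1)) //= big_nat_recr //=.
by rewrite divff ?subrr ?mulr0 ?mul0r // pnatr_eq0 -lt0n.
Qed.

Lemma bounded1_lowfac : bounded1 (lowfac (k%:R^-1 : R)).
Proof.
move=> l; case: (leqP k l) => [/lowfac_eq0 ->|]; first by rewrite normr0.
elim: l => [|l IH] lk; first by rewrite /lowfac big_geq // normr1.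
rewrite lowfacS normrM -[X in _ <= X]mulr1 ler_pM //; first exact/IH/ltnW.
have h0 : 0 <= l.+1%:R * k%:R^-1 :> R by rewrite mulr_ge0 // invr_ge0.
have h1 : l.+1%:R * k%:R^-1 <= 1 :> R.
  by rewrite ler_pdivrMr ?ltr0n // mul1r ler_nat ltnW.
by rewrite ler_norml; apply/andP; split; lra.
Qed.

End FactorBounds.

Section Zeros.
Variable R : realType.
Implicit Types (q x y w : R).

Definition fterm q x (n : nat) : R := x ^+ n / (n`!)%:R * q ^+ (n * n.-1)./2.

Lemma ftermS q x n : fterm q x n.+1 = fterm q x n * (x * q ^+ n / n.+1%:R).
Proof.
rewrite /fterm -!bin2 binS bin1 [q ^+ (_ + _)]exprD factS natrM invfM [x ^+ n.+1]exprS.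
by move: (n.+1%:R^-1) (n`!%:R^-1) => a b; ring.
Qed.

Lemma fterm_opp q x n : fterm q (- x) n = (-1) ^+ n * fterm q x n.
Proof. by rewrite /fterm [(- x) ^+ n]exprNn !mulrA. Qed.

Lemma is_cvg_fterm q x : 0 <= q <= 1 -> cvgn (series (fterm q x)).
Proof.
move=> /andP[q0 q1]; apply: normed_cvg; apply: (@series_le_cvg _ _ (exp_coeff `|x|)).
- by move=> n /=.
- by move=> n; rewrite /exp_coeff /= mulr_ge0 ?exprn_ge0 ?invr_ge0.
- move=> n /=; rewrite /fterm /exp_coeff /= !normrM normrX normfV normr_nat.
  rewrite -[X in _ <= X]mulr1 ler_wpM2l ?mulr_ge0 ?exprn_ge0 ?invr_ge0 //.
  by rewrite normrX ger0_norm // exprn_ile1.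
- exact: is_cvg_series_exp_coeff.
Qed.

Section PartialSum.
Variables (K : nat) (q x w : R).
Hypotheses (q0 : 0 < q) (w0 : w != 0) (hx : x * q ^+ K = - (K.+1%:R * w)).
Let s : R := K.+1%:R^-1.

Let K0 : K.+1%:R != 0 :> R. Proof. by rewrite pnatr_eq0. Qed.

Lemma fterm_pivot : fterm q x K.+1 = fterm q x K * - w.
Proof. by rewrite ftermS hx; congr (_ * _); field. Qed.

(** By [ftermS], the ratio of the terms at [K + 2 + l] and [K + 1 + l] is
    [- w q^(l+1) / (1 + (l + 1) s)]; the powers of [q] accumulate to [q^(triang l)]. *)
Lemma fterm_above l : fterm q x (K.+1 + l) =
  fterm q x K.+1 * ((-1) ^+ l * invfac s l * q ^+ triang l * w ^+ l).
Proof.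
elim: l => [|l IH]; first by rewrite addn0 /invfac big_geq // triang0 !expr0 !mulr1.
have eI : invfac s l.+1 = invfac s l * (1 + l.+1%:R * s)^-1.
  by rewrite /invfac big_nat_recr.
have r1 : x * q ^+ (K.+1 + l) / (K.+1 + l).+1%:R = - (w * q ^+ l.+1 * (1 + l.+1%:R * s)^-1).
  have -> : (K.+1 + l).+1%:R = K.+1%:R * (1 + l.+1%:R * s) :> R.
    by rewrite mulrDr mulr1 mulrCA divff // mulr1 -natrD addnS.
  rewrite addSnnS exprD mulrA hx invfM !mulNr; congr (- _).
  have h : K.+1%:R * K.+1%:R^-1 = 1 :> R by rewrite divff.
  move: (K.+1%:R) (K.+1%:R^-1) h (1 + _)^-1 (q ^+ _) => m t h u v.
  by rewrite -[RHS]mul1r -h; ring.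
rewrite addnS ftermS IH r1 eI triangS (exprD q (triang l)) [(-1) ^+ l.+1]exprS [w ^+ l.+1]exprS.
move: (1 + _)^-1 (q ^+ l.+1) (invfac s l) (fterm _ _ _) (q ^+ _) ((-1) ^+ l) (w ^+ l).
by move=> *; ring.
Qed.

Lemma fterm_below l : (l <= K)%N -> fterm q x (K - l) =
  fterm q x K * ((-1) ^+ l * lowfac s l * q ^+ triang l * w^-1 ^+ l).
Proof.
elim: l => [|l IH] lK; first by rewrite subn0 /lowfac big_geq // triang0 !expr0 !mulr1.
have eK : (K - l = (K - l.+1).+1)%N by lia.
have := IH (ltnW lK); rewrite eK ftermS => h.
have eL : 1 - l.+1%:R * s = (K - l.+1).+1%:R * s.
  by rewrite -eK -subSS natrB ?ltnS ?(ltnW lK) // mulrBl /s divff.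
have e1 : (x * q ^+ (K - l.+1) / (K - l.+1).+1%:R) *
    (- ((1 - l.+1%:R * s) * q ^+ l.+1 * w^-1)) = 1.
  rewrite eL.
  transitivity (- ((x * (q ^+ (K - l.+1) * q ^+ l.+1)) * s * w^-1 *
     ((K - l.+1).+1%:R / (K - l.+1).+1%:R))); first by ring.
  rewrite -exprD subnK // hx divff ?pnatr_eq0 // mulr1 /s.
  by rewrite !mulNr opprK [_ * w]mulrC mulfK // divff.
have := congr1 (fun z => fterm q x (K - l.+1) * z) e1; rewrite /= mulr1 => <-.
rewrite mulrA h lowfacS triangS (exprD q (triang l)) [(-1) ^+ l.+1]exprS.
rewrite [w^-1 ^+ l.+1]exprS.
move: (q ^+ l.+1) (lowfac s l) (fterm _ _ _) (q ^+ _) ((-1) ^+ l) (w^-1 ^+ l) (w^-1) (1 - _).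
by move=> *; ring.
Qed.

Lemma series_fterm N : (K <= N)%N -> series (fterm q x) (K.+1 + N).+1 =
  fterm q x K * (wstep (invfac s) (lowfac s) q w w^-1 N - w).
Proof.
move=> KN; rewrite seriesEnat /= (big_cat_nat _ (n := K.+1)) //=; last by lia.
have -> : \sum_(0 <= i < K.+1) fterm q x i = fterm q x K * (1 + altsum (lowfac s) q w^-1 N).
  have -> : altsum (lowfac s) q w^-1 N = altsum (lowfac s) q w^-1 K.
    rewrite /altsum (big_cat_nat _ (n := K.+1)) //= [X in _ + X]big_nat.
    rewrite [X in _ + X]big1 ?addr0 // => l /andP[Kl _].
    by rewrite /s lowfac_eq0 // mulr0 !mul0r.
  rewrite big_nat_rev.
  transitivity (\sum_(0 <= l < K.+1)
      fterm q x K * ((-1) ^+ l * lowfac s l * q ^+ triang l * w^-1 ^+ l)).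
    rewrite !big_nat; apply: eq_bigr => l /andP[_ lK].
    by rewrite add0n subSS fterm_below.
  rewrite -mulr_sumr big_ltn //; congr (_ * (_ + _)).
  by rewrite /lowfac big_geq // triang0 !expr0 !mulr1.
have -> : \sum_(K.+1 <= i < (K.+1 + N).+1) fterm q x i =
    fterm q x K * - w * (1 + altsum (invfac s) q w N).
  rewrite -addnS -{1}[K.+1]add0n [(K.+1 + _)%N]addnC big_addn addnK.
  transitivity (\sum_(0 <= l < N.+1)
      fterm q x K.+1 * ((-1) ^+ l * invfac s l * q ^+ triang l * w ^+ l)).
    by apply: eq_bigr => l _; rewrite addnC fterm_above.
  rewrite -mulr_sumr big_ltn // fterm_pivot; congr (_ * (_ + _)).
  by rewrite /invfac big_geq // triang0 !expr0 !mulr1.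
rewrite /wstep; ring.
Qed.

End PartialSum.

(** By [series_fterm], partial sums of [f] are the residual times the term of index [K], which is
    nonzero and independent of [N]. *)
Lemma fq_zeroP K q x w : 0 < q < 1 -> w != 0 -> x * q ^+ K = - (K.+1%:R * w) ->
  fq q x = 0 <-> (fun N => wstep (invfac (K.+1%:R^-1 : R)) (lowfac K.+1%:R^-1) q w w^-1 N - w)
     @ \oo --> (0 : R).
Proof.
move=> /andP[q0 q1] w0 hx.
set h := (fun N => _).
have cf : series (fterm q x) @ \oo --> fq q x.
  by apply: is_cvg_fterm; rewrite !ltW.
have x0 : x != 0.
  apply: contra_neq w0 => x0; move: hx; rewrite x0 mul0r => /esym/eqP.
  by rewrite oppr_eq0 mulf_eq0 pnatr_eq0 /= => /eqP.
have t0 : fterm q x K != 0.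
  apply: mulf_neq0; last by rewrite expf_neq0 // gt_eqF.
  by rewrite mulf_neq0 ?expf_neq0 // invr_neq0 // pnatr_eq0 -lt0n fact_gt0.
have cs : (fun N => series (fterm q x) (N + K.+2)%N) @ \oo --> fq q x.
  by rewrite (cvg_shiftn K.+2 (series (fterm q x))).
have ch : (fun N => fterm q x K * h N) @ \oo --> fq q x.
  rewrite -(cvg_shiftn K) /=.
  have -> : (fun N => fterm q x K * h (N + K)%N) =
      (fun N => series (fterm q x) (N + K + K.+2)%N).
    apply/funext => N; rewrite /h -series_fterm ?leq_addl //; congr (series _ _); lia.
  by rewrite -(cvg_shiftn K) in cs.
split=> [f0|ch0].
  rewrite f0 in ch.
  have -> : h = (fun N => (fterm q x K)^-1 * (fterm q x K * h N)).
    by apply/funext => N; rewrite mulKf.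
  exact: cvg0Z.
have := cvg0Z (fterm q x K) ch0.
exact: (cvg_unique _ ch).
Qed.

End Zeros.

(** * Uniqueness and localization of the zeros *)

Section Localization.
Variable R : realType.
Implicit Types (q x y w : R).

(** On [[1/4, 4]] inversion has Lipschitz constant 16, so the step has constant
    [16 * 16 q + 128 q = 384 q < 1/2]. The window is the one that [fq_zero_localized] provides. *)
Lemma fixpoint_unique (a b : nat -> R) q w w' : bounded1 a -> bounded1 b -> 0 <= q <= rho R ->
  4^-1 <= w <= 4 -> 4^-1 <= w' <= 4 ->
  (fun N => wstep a b q w w^-1 N - w) @ \oo --> (0 : R) ->
  (fun N => wstep a b q w' w'^-1 N - w') @ \oo --> (0 : R) -> w = w'.
Proof.
move=> ha hb hq /andP[w1 w4] /andP[w1' w4'] hw hw'.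
have p (z : R) : 4^-1 <= z -> z <= 4 -> [/\ 0 < z, `|z| <= 4 & `|z^-1| <= 4].
  move=> z1 z4; have z0 : 0 < z by lra.
  have z0' := ltW z0; split=> //; rewrite ?normfV (ger0_norm z0') //.
  by rewrite -[X in _ <= X]invrK lef_pV2 ?posrE ?invr_gt0.
have [w0 n1 n2] := p w w1 w4; have [w0' n1' n2'] := p w' w1' w4'.
apply/eqP; rewrite -subr_eq0 -normr_le0.
have hl : (fun N => 2 * `|(wstep a b q w w^-1 N - w) + -1 * (wstep a b q w' w'^-1 N - w')|)
    @ \oo --> (0 : R).
  by apply: cvg0Z; apply: cvg0_norm; apply: cvg0D => //; apply: cvg0Z.
apply: (cvgr_to_ge hl); apply: nearW => N.
have := @wstep_lipschitz R a b q w w' w^-1 w'^-1 N ha hb hq n1 n1' n2 n2'.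
have hv : `|w^-1 - w'^-1| <= 16 * `|w - w'|.
  have -> : w^-1 - w'^-1 = w^-1 * w'^-1 * (w' - w) by field; rewrite !gt_eqF.
  rewrite !normrM (distrC w') ler_wpM2r //.
  have -> : 16 = 4 * 4 :> R by ring.
  exact: ler_pM.
set X := wstep a b q w w^-1 N; set Y := wstep a b q w' w'^-1 N => hl1.
have hd : `|w - w'| <= `|X - w + -1 * (Y - w')| + `|X - Y|.
  have -> : w - w' = - (X - w + -1 * (Y - w')) + (X - Y) by ring.
  by rewrite (le_trans (ler_normD _ _)) // normrN.
have d0 := normr_ge0 (w - w'); have /andP[q0 qr] := hq; rewrite /rho in qr.
have h3 : 16 * q * `|w^-1 - w'^-1| <= 16 * q * (16 * `|w - w'|).
  by apply: ler_wpM2l => //; lra.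
have h4 : q * `|w - w'| <= 1000^-1 * `|w - w'| by apply: ler_wpM2r.
lra.
Qed.

Lemma dominant_below (c : nat -> R) i : (forall n, 0 <= c n) ->
  (forall n, (n < i)%N -> 4 * c n <= c n.+1) ->
  3 * \sum_(0 <= n < i) c n <= c i.
Proof.
move=> c0 h; have : (i <= i)%N by []; elim: {-2}i => [|m IH] mi; first by rewrite big_geq ?mulr0.
rewrite big_nat_recr //=; have := h m mi; have := IH (ltnW mi); lra.
Qed.

(** The inequality [3 c_(n+1) <= c_n - c_(n+1)] telescopes. Together with [dominant_below], each
    side of [c i] sums to at most a third of it, so a third remains. *)
Lemma dominant_above (c : nat -> R) i p : (forall n, 0 <= c n) ->
  (forall n, (i <= n)%N -> 4 * c n.+1 <= c n) ->
  3 * \sum_(i.+1 <= n < (i + p).+1) c n <= c i - c (i + p)%N.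
Proof.
move=> c0 h; elim: p => [|p IH]; first by rewrite addn0 big_geq // mulr0 subrr.
rewrite addnS big_nat_recr /=; last by lia.
have := h (i + p)%N (leq_addr _ _); lra.
Qed.

Lemma dominant_neq0 (c : nat -> R) (l : R) i : (forall n, 0 < c n) ->
  (forall n, (n < i)%N -> 4 * c n <= c n.+1) ->
  (forall n, (i <= n)%N -> 4 * c n.+1 <= c n) ->
  series (fun n => (-1) ^+ n * c n) @ \oo --> l -> l != 0.
Proof.
move=> c0 hb ha hl; have c0' n : 0 <= c n by exact: ltW.
have hn : (fun N => `|series (fun n => (-1) ^+ n * c n) N|) @ \oo --> `|l| by exact: cvg_norm.
suff : c i / 3 <= `|l|.
  by move=> h; rewrite -normr_gt0; apply: lt_le_trans h; have := c0 i; lra.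
apply: (cvgr_to_ge hn); near=> N.
have iN : (i < N)%N by near: N; exact: nbhs_infty_gt.
have nsum m n : `|\sum_(m <= j < n) (-1) ^+ j * c j| <= \sum_(m <= j < n) c j.
  rewrite (le_trans (ler_norm_sum _ _ _)) //; apply: ler_sum => j _.
  by rewrite normrMsign ger0_norm.
rewrite seriesEnat /= (big_cat_nat _ (n := i)) //= ?(ltnW iN) // (big_ltn iN).
have eN : (N = (i + (N.-1 - i)).+1)%N by lia.
have h1 := dominant_below c0' hb; have h2 := @dominant_above c i (N.-1 - i) c0' ha.
rewrite -eN in h2.
have n1 := nsum 0%N i; have n2 := nsum i.+1 N.
set A := \sum_(0 <= j < i) _ in n1 *; set B := \sum_(i.+1 <= j < N) _ in n2 *.
have hc : c i = `|(-1) ^+ i * c i| by rewrite normrMsign ger0_norm.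
have hd : `|(-1) ^+ i * c i| <= `|A + ((-1) ^+ i * c i + B)| + (`|A| + `|B|).
  move: ((-1) ^+ i * c i) => D; have e : D = (A + (D + B)) - (A + B) by ring.
  by rewrite {1}e (le_trans (ler_normB _ _)) // lerD2l ler_normD.
have := c0' (i + (N.-1 - i))%N; lra.
Unshelve. all: by end_near.
Qed.

Lemma fq_neg q y : 0 < q < 1 -> fq q y = 0 -> y < 0.
Proof.
move=> /andP[q0 q1] f0; rewrite ltNge; apply/negP => y0.
have cf : series (fterm q y) @ \oo --> fq q y by apply: is_cvg_fterm; rewrite !ltW.
suff : 1 <= fq q y by rewrite f0; lra.
apply: (cvgr_to_ge cf); near=> N.
have N0 : (0 < N)%N by near: N; exact: nbhs_infty_gt.
rewrite seriesEnat /= big_ltn // {1}/fterm !expr0 divr1 mulr1 lerDl.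
by apply: sumr_ge0 => n _; rewrite /fterm !mulr_ge0 ?exprn_ge0 ?invr_ge0 // ltW.
Unshelve. all: by end_near.
Qed.

(* Consecutive terms of f(y) have ratios [y q^(j-1) / j], decreasing by a factor at least [q];
   unless one of these ratios is of order one, a single term dominates the series. *)
Lemma fq_zero_localized q y k : 0 < q < rho R -> fq q y = 0 ->
  - y * q ^+ k / k.+1%:R < 4 ->
  exists2 j, (j <= k)%N & 4^-1 <= - y * q ^+ j / j.+1%:R <= 4.
Proof.
move=> /andP[q0 qr] f0 hk; have q1 : q < 1 by move: qr; rewrite /rho; lra.
have q01 : 0 < q < 1 by rewrite q0.
have y0 := fq_neg q01 f0; set s := - y; have s0 : 0 < s by rewrite oppr_gt0.
pose g j := s * q ^+ j / j.+1%:R.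
have g0 j : 0 < g j by rewrite /g divr_gt0 ?mulr_gt0 ?exprn_gt0 ?ltr0n.
have gS j : g j.+1 <= q * g j.
  have -> : g j.+1 = q * (s * q ^+ j / j.+2%:R) by rewrite /g exprS mulrCA !mulrA.
  apply: ler_wpM2l; first exact: ltW.
  apply: ler_wpM2l; first by rewrite mulr_ge0 ?exprn_ge0 // ltW.
  by rewrite lef_pV2 ?posrE ?ltr0n // ler_nat.
have exj : exists j, g j < 4 by exists k.
(* [j] is the least index with ratio below 4, so earlier ratios are at least 4. Were the ratio at
   [j] below [1/4], so would be all later ones, and [c j] would dominate. *)
have [j gj minj] := ex_minnP exj; exists j; first exact: minj.
rewrite -/s -/(g j) (ltW gj) andbT leNgt; apply/negP => gj4.
pose c n := fterm q s n.
have c0 n : 0 < c n.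
  rewrite /c /fterm !mulr_gt0 ?exprn_gt0 ?invr_gt0 ?ltr0n ?fact_gt0 //.
have cS n : c n.+1 = c n * g n by rewrite /c ftermS.
have gdec m n : (m <= n)%N -> g n <= g m.
  move=> /subnKC <-; elim: (n - m)%N => [|d IH]; first by rewrite addn0.
  rewrite addnS (le_trans (gS _)) // (le_trans _ IH) //.
  by apply: ler_piMl; exact: ltW.
have : fq q y != 0.
  apply: (@dominant_neq0 c _ j) => //.
  - move=> n nj; rewrite cS mulrC; apply: ler_wpM2l; first exact: ltW.
    rewrite leNgt; apply/negP => h.
    by have := minj n h; rewrite leqNgt nj.
  - move=> n jn; rewrite cS; have := gdec _ _ jn; have := c0 n; nra.
  have -> : (fun n => (-1) ^+ n * c n) = fterm q y.
    by apply/funext => n; rewrite /c -fterm_opp opprK.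
  by apply: is_cvg_fterm; rewrite !ltW.
by rewrite f0 eqxx.
Qed.

End Localization.

Lemma rho_gt0 (R : realType) : 0 < rho R. Proof. by rewrite /rho; lra. Qed.

(** Every zero above the k-th candidate lies in the window of some index [j <= k - 1], equals the
    candidate with that index by uniqueness, and [j = k - 1] is excluded. As the candidates decrease
    strictly, exactly [k - 1] zeros lie above. *)
Lemma zeros_of_fq (R : realType) (q : R) : 0 < q < rho R -> exists w : nat -> R,
  forall k, (0 < k)%N ->
  [/\ series (fun n => (sol n (invfac (k%:R^-1 : R)) (lowfac k%:R^-1))`_n * q ^+ n)
        @ \oo --> w k,
      series (fun n => (sol n (lowfac (k%:R^-1 : R)) (invfac k%:R^-1))`_n * q ^+ n)
        @ \oo --> (w k)^-1 &
      kth_zero q k (- (k%:R * w k) / q ^+ k.-1)].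
Proof.
move=> hq; have /andP[q0 qr] := hq.
have qq : 0 <= q <= rho R by rewrite !ltW.
have q1 : q < 1 by move: qr; rewrite /rho; lra.
have q01 : 0 < q < 1 by rewrite q0.
have hw k : exists w : R, (0 < k)%N ->
  [/\ series (fun n => (sol n (invfac (k%:R^-1 : R)) (lowfac k%:R^-1))`_n * q ^+ n)
        @ \oo --> w,
      series (fun n => (sol n (lowfac (k%:R^-1 : R)) (invfac k%:R^-1))`_n * q ^+ n)
        @ \oo --> w^-1, `|w - 1| <= 2^-1 &
      (fun N => wstep (invfac (k%:R^-1 : R)) (lowfac k%:R^-1) q w w^-1 N - w) @ \oo --> (0 : R)].
  case: (posnP k) => [->|k0]; first by exists 0.
  have [w [v [h1 h2 h3 h4 h5]]] :=
    sol_fixpoint (bounded1_invfac R k) (bounded1_lowfac R k0) hq.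
  have w0 : w != 0 by apply: contra_eq_neq h4 => ->; rewrite mul0r eq_sym oner_eq0.
  have ev : v = w^-1 by rewrite -[LHS]mul1r -(mulVf w0) -mulrA h4 mulr1.
  by exists w => _; rewrite -ev.
have [w {}hw] := choice hw.
pose x k : R := - (k%:R * w k) / q ^+ k.-1.
have wb k : (0 < k)%N -> 2^-1 <= w k <= 3 / 2.
  by move=> /hw[_ _ + _]; rewrite ler_norml => /andP[? ?]; apply/andP; split; lra.
have xq K : x K.+1 * q ^+ K = - (K.+1%:R * w K.+1).
  by rewrite /x /= divfK // expf_neq0 // gt_eqF.
have fx K : fq q (x K.+1) = 0.
  have [_ _ _ hf] := hw K.+1 isT.
  have /andP[? ?] := wb K.+1 isT.
  by apply/(fq_zeroP q01 _ (xq K)) => //; rewrite gt_eqF //; lra.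
have uniqx y K : fq q y = 0 -> 4^-1 <= - y * q ^+ K / K.+1%:R <= 4 -> y = x K.+1.
  move=> fy hy; pose z := - y * q ^+ K / K.+1%:R.
  have yz : y * q ^+ K = - (K.+1%:R * z) 
    by rewrite /z [K.+1%:R * _]mulrC divfK ?pnatr_eq0 // mulNr opprK.
  have /andP[z1 z4] := hy; rewrite -/z in z1 z4.
  have zn0 : z != 0 by rewrite gt_eqF //; lra.
  have hz := (fq_zeroP q01 zn0 yz).1 fy.
  have [_ _ _ hf] := hw K.+1 isT; have /andP[? ?] := wb K.+1 isT.
  have e : z = w K.+1.
    apply: (fixpoint_unique (bounded1_invfac R K.+1) (bounded1_lowfac R (ltn0Sn K)) qq) => //.
    by apply/andP; split; lra.
  apply: (mulIf (_ : q ^+ K != 0)); first by rewrite expf_neq0 // gt_eqF.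
  by rewrite xq -e.
have xlt K : x K.+2 < x K.+1.
  rewrite -(ltr_pM2r (_ : 0 < q ^+ K.+1)) ?exprn_gt0 // xq exprSr mulrA xq mulNr ltrN2.
  have /andP[? ?] := wb K.+1 isT; have /andP[? ?] := wb K.+2 isT.
  have k0 : 0 <= K.+1%:R :> R by [].
  have -> : K.+2%:R = K.+1%:R + 1 :> R by rewrite natr1.
  move: (K.+1%:R) k0 => m m0; have qr' : q <= 1000^-1 by rewrite ltW.
  have h1 : m * w K.+1 * q <= m * (3 / 2) * 1000^-1.
    by apply: ler_pM; [rewrite mulr_ge0 //; lra|lra|rewrite ler_wpM2l|].
  have h2 : (m + 1) * 2^-1 <= (m + 1) * w K.+2 by rewrite ler_wpM2l //; lra.
  lra.
have xdec i j : (i < j)%N -> x j.+1 < x i.+1.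
  move=> /subnKC <-; elim: (j - i.+1)%N => [|d IH]; first by rewrite addn0.
  by rewrite addnS (lt_trans (xlt _)).
exists w; case=> // K _; have [h1 h2 _ _] := hw K.+1 isT; split=> //.
rewrite -/(x K.+1); split; first exact: fx.
exists [seq x i.+1 | i <- iota 0 K]; split; [|split].
- rewrite map_inj_uniq ?iota_uniq // => i j e.
  by case: (ltngtP i j) => // /xdec; rewrite e ltxx.
- by rewrite size_map size_iota.
move=> y; split.
  move=> /mapP[i]; rewrite mem_iota => /= iK ->; split; first exact: fx.
  exact: xdec.
move=> [fy xy].
(* Since [y > x K.+1], this ratio is below [w K.+1 <= 3/2]; localization then yields an index
   [j <= K]. *)
have hk : - y * q ^+ K / K.+1%:R < 4.
  apply: (@lt_trans _ _ (w K.+1)); last by have /andP[_ ?] := wb K.+1 isT; lra.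
  rewrite ltr_pdivrMr ?ltr0n // mulrC mulrN ltrNl mulrC -xq.
  by rewrite [X in _ < X]mulrC ltr_pM2r ?exprn_gt0.
have [j jK hj] := fq_zero_localized hq fy hk.
have ey := uniqx _ _ fy hj.
rewrite ey; apply/mapP; exists j => //; rewrite mem_iota /= add0n.
rewrite ltn_neqAle jK andbT; apply/eqP => e.
by move: xy; rewrite ey e ltxx.
Qed.

Theorem theorem3 (R : realType) :
  exists P Ph : nat -> {poly int},
    (* (i): for each k >= 1, near q = 0+ the k-th zero x_k(q) exists and
       w_k(q) = -q^(k-1) x_k(q)/k = 1 + sum_{n>=1} (P_n(k)/Q_n(k)) q^n,
       1/w_k(q) = 1 - sum_{n>=1} (Ph_n(k)/Q_n(k)) q^n  (convergent series) *)
    (forall k : nat, (0 < k)%N ->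
      exists r : R, 0 < r /\ r <= 1 /\
        forall q : R, 0 < q < r ->
          exists x : R, kth_zero q k x /\
            series (fun n : nat =>
                (if n == 0%N then 1 else coef_ratio (P n) n k) * q ^+ n) @ \oo
              --> (- (q ^+ k.-1 * x) / k%:R) /\
            series (fun n : nat =>
                (if n == 0%N then 1 else - coef_ratio (Ph n) n k) * q ^+ n) @ \oo
              --> (- (q ^+ k.-1 * x) / k%:R)^-1)
    (* (ii) *)
    /\ (forall n : nat, (0 < n)%N -> (Mdeg n < 3 * n)%N)
    /\ ((fun n : nat => (Mdeg n)%:R / n%:R : R) @ \oo --> (3 : R))
    /\ (forall n : nat, (2 <= n)%N -> has_form (P n) n /\ has_form (Ph n) n)
    /\ (sigma 2)%:Z * ((mu 1 2)%:Z - 2%:Z) = 0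
    /\ (forall n : nat, (3 <= n)%N -> 0 < (sigma n)%:Z * ((mu 1 n)%:Z - n%:Z)).
Proof.
have [P [Ph [hP hform]]] := sol_rational R; exists P, Ph.
split; last first.
  split; first exact: Mdeg_lt.
  split; first exact: Mdeg_ratio_cvg.
  split; first exact: hform.
  split; first by rewrite mu1_2 subrr mulr0.
  move=> n n3; rewrite mulr_gt0 // ?ltz_nat ?sigma_gt0 //; first by lia.
  by rewrite subr_gt0 ltz_nat mu1_gt.
move=> k k0; exists (rho R); split; first exact: rho_gt0.
split; first by rewrite /rho; lra.
move=> q hq; have [w hw] := zeros_of_fq hq; have [h1 h2 h3] := hw k k0.
exists (- (k%:R * w k) / q ^+ k.-1); split=> //.
have /andP[q0 _] := hq.
have -> : - (q ^+ k.-1 * (- (k%:R * w k) / q ^+ k.-1)) / k%:R = w k.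
  rewrite mulrCA divff ?expf_neq0 ?gt_eqF // mulr1 opprK mulrC mulKf //.
  by rewrite pnatr_eq0 -lt0n.
split.
  have -> : (fun n => (if n == 0%N then 1 else coef_ratio (P n) n k) * q ^+ n) =
    (fun n => (sol n (invfac (k%:R^-1 : R)) (lowfac k%:R^-1))`_n * q ^+ n); last exact: h1.
  apply/funext => -[|n] /=; first by rewrite coef1.
  by have [-> _] := hP n.+1 k isT k0.
have -> : (fun n => (if n == 0%N then 1 else - coef_ratio (Ph n) n k) * q ^+ n) =
  (fun n => (sol n (lowfac (k%:R^-1 : R)) (invfac k%:R^-1))`_n * q ^+ n); last exact: h2.
apply/funext => -[|n] /=; first by rewrite coef1.
by have [_ ->] := hP n.+1 k isT k0.
Qed.
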